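(* Let $R=(S+S)\cup(\{0,\pm\epsilon\}+S)$ be an extended affine root system of type $A_1$ and nullity $\nu$ in $A$, where $S=\bigcup_{i=0}^m(\tau_i+2\Lambda)$, and let $\Pi=\{\alpha_0=\epsilon,\alpha_1=\epsilon+\tau_1,\ldots,\alpha_m=\epsilon+\tau_m\}$ be the associated reflectable base for $R$, where $\{\sigma_1=\tau_1,\dots,\sigma_\nu=\tau_\nu\}$ is a $\mathbb{Z}$-basis of $\Lambda$. Assume that $\Pi$ is elliptic-like. Then the hyperbolic Weyl group (extended affine Weyl group) $\widetilde{\mathcal{W}}$ of $R$ is isomorphic to the group $\widetilde{G}$ defined by generators: $\widetilde{x}_k$, $0\leq k\leq m$; relations (for $0\le k\le m$, $1\le i<j\le\nu$, $\nu+1\le s\le m$): $\widetilde{x}_k^2=1$; $[\widetilde{x}_k,\ \widetilde{x}_s\widetilde{x}_i\widetilde{x}_0\widetilde{x}_j]=1$ if $\{i,j\}=\mathrm{supp}(\alpha_s)$; $[\widetilde{x}_k,\ (\widetilde{x}_i\widetilde{x}_0\widetilde{x}_j)^2]=1$ if $\{i,j\}\notin\mathrm{supp}(\Pi)$.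
   Context: Notation: $[x,y]=xyx^{-1}y^{-1}$. Let $A$ be an abelian group with a nontrivial symmetric positive semidefinite bi-homomorphism $(\cdot,\cdot):A\times A\to\mathbb{Q}$ with radical $A^0$. For $B\subseteq A$ put $B^\times=B\setminus A^0$, $B^0=B\cap A^0$. Put $(\beta,\alpha^\vee)=2(\beta,\alpha)/(\alpha,\alpha)$ if $(\alpha,\alpha)\neq0$ and $0$ otherwise. An affine reflection system in $A$ is a subset $R$ with (R1) $R=-R$; (R2) $\langle R\rangle=A$; (R3) for $\alpha\in R^\times$, $\beta\in R$ there are $d,u\in\mathbb{Z}_{\ge0}$ with $(\beta+\mathbb{Z}\alpha)\cap R=\{\beta-d\alpha,\dots,\beta+u\alpha\}$ and $d-u=(\beta,\alpha^\vee)$. It is irreducible if $R^\times$ is not a disjoint union of two nonempty orthogonal subsets, tame if $R^0\subseteq R^\times-R^\times$, and of type $A_1$ if its image in $A/A^0$ is $\{0,\pm\bar\epsilon\}$. An extended affine root system of type $A_1$ and nullity $\nu$ means here a tame irreducible affine reflection system of type $A_1$ with $\Lambda:=A^0$ free abelian of finite rank $\nu$. Then $A=\mathbb{Z}\epsilon\oplus\Lambda$, and $R=(S+S)\cup(\{0,\pm\epsilon\}+S)$ with $S\subseteq\Lambda$, $0\in S$, $S\pm2S\subseteq S$, $\langle S\rangle=\Lambda$; normalize $(\epsilon,\epsilon)=2$. One has $S=\bigcup_{i=0}^m(\tau_i+2\Lambda)$ with $\tau_0=0$ and $\tau_0,\dots,\tau_m$ representing distinct cosets of $2\Lambda$ in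 $\Lambda$, and the $\tau_i$ are chosen so that $\sigma_1:=\tau_1,\dots,\sigma_\nu:=\tau_\nu$ form a $\mathbb{Z}$-basis of $\Lambda$. The set $\Pi=\{\alpha_0=\epsilon,\alpha_i=\epsilon+\tau_i\ (1\le i\le m)\}$ is then a reflectable base: with $\mathcal{W}_P$ the group generated by the reflections $w_\alpha(\beta)=\beta-(\beta,\alpha^\vee)\alpha$ of $A$ for $\alpha\in P$, one has $\mathcal{W}_\Pi\Pi=R^\times$ and no proper subset of $\Pi$ has this property. Each $\alpha\in R^\times$ is uniquely $\pm\epsilon+\sum_{i=1}^\nu s_i\sigma_i$ modulo $2\Lambda$ with $s_i\in\{0,1\}$; put $\mathrm{supp}(\alpha)=\{i\mid s_i\ne0\}$ and $\mathrm{supp}(\Pi)=\{\mathrm{supp}(\alpha)\mid\alpha\in\Pi\}$. $\Pi$ is elliptic-like if $|\mathrm{supp}(\alpha)|\in\{0,1,2\}$ for all $\alpha\in\Pi$ (equivalently $|\mathrm{supp}(\alpha_k)|=2$ for $\nu+1\le k\le m$). Hyperbolic Weyl group: let $\mathcal{V}=\mathbb{R}\otimes_{\mathbb{Z}}A=\mathbb{R}\epsilon\oplus\mathcal{V}^0$, $\mathcal{V}^0=\mathrm{span}_{\mathbb{R}}\Lambda$, with the extended form, and identify $A$ and $R$ with subsets of $\mathcal{V}$. Let $\lambda_1,\dots,\lambda_\nu$ be the basis of $(\mathcal{V}^0)^\star$ dual to $\sigma_1,\dots,\sigma_\nu$, and $\widetilde{\mathcal{V}}=\mathcal{V}\oplus(\mathcal{V}^0)^\star$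 with the form extended to a symmetric bilinear form by $(\epsilon,(\mathcal{V}^0)^\star)=((\mathcal{V}^0)^\star,(\mathcal{V}^0)^\star)=0$, $(\sigma,\lambda)=\lambda(\sigma)$ for $\sigma\in\mathcal{V}^0,\lambda\in(\mathcal{V}^0)^\star$. For $\alpha\in\mathcal{V}$, $w_\alpha(\beta)=\beta-(\beta,\alpha^\vee)\alpha$ for $\beta\in\widetilde{\mathcal{V}}$. $\widetilde{\mathcal{W}}$ is the subgroup of $\mathrm{Aut}(\widetilde{\mathcal{V}})$ generated by $w_\alpha$, $\alpha\in R$. *)

(* Defs.v *)
From HB Require Import structures.
From mathcomp Require Import all_boot all_order all_algebra generic_quotient.
From mathcomp Require Import boolp classical_sets reals.

Set Implicit Arguments.
Unset Strict Implicit.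
Unset Printing Implicit Defensive.

Import GRing.Theory Num.Theory.

Local Open Scope ring_scope.
Local Open Scope classical_set_scope.
Local Open Scope quotient_scope.

Definition isomorphic (G H : groupType) : Prop :=
  exists f : {multiplicative G -> H}, bijective f.

(* A letter [(x, b)] is the generator [x] if [b = false], and its formal
   inverse if [b = true]. *)
Definition word (X : Type) : Type := seq (X * bool).

Definition wgen (X : Type) (x : X) : word X := [:: (x, false)].

Definition winv (X : Type) (w : word X) : word X :=
  rev [seq (l.1, ~~ l.2) | l <- w].

(* [x, y] = x y x^-1 y^-1, as opposed to [x^-1 y^-1 x y] for MathComp's
   [[~ x, y]]. *)
Definition wcomm (X : Type) (u v : word X) : word X :=
  u ++ v ++ winv u ++ winv v.

Inductive pres_cong (X : Type) (rels : set (word X)) : word X -> word X -> Prop :=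
| PresRefl u : pres_cong rels u u
| PresSym u v : pres_cong rels u v -> pres_cong rels v u
| PresTrans u v w : pres_cong rels u v -> pres_cong rels v w -> pres_cong rels u w
| PresCat u u' v v' : pres_cong rels u u' -> pres_cong rels v v' ->
    pres_cong rels (u ++ v) (u' ++ v')
| PresCancel x b : pres_cong rels [:: (x, b); (x, ~~ b)] [::]
| PresRel r : rels r -> pres_cong rels r [::].

Section PresentedGroup.
Variables (X : choiceType) (rels : set (word X)).

Definition pres_eq : rel (word X) := fun u v => `[< pres_cong rels u v >].

Lemma pres_eq_refl : reflexive pres_eq.
Proof. by move=> u; apply/asboolP; exact: PresRefl. Qed.

Lemma pres_eq_sym : symmetric pres_eq.
Proof. by move=> u v; apply/asboolP/asboolP; exact: PresSym. Qed.

Lemma pres_eq_trans : transitive pres_eq.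
Proof.
by move=> v u w /asboolP uv /asboolP vw; apply/asboolP; exact: PresTrans uv vw.
Qed.

Canonical pres_equiv :=
  EquivRel pres_eq pres_eq_refl pres_eq_sym pres_eq_trans.

Definition presented_group : Type := {eq_quot pres_equiv}.

HB.instance Definition _ := Choice.on presented_group.

Definition pres_class (w : word X) : presented_group :=
  \pi_({eq_quot pres_equiv}) w.

Definition pres_repr (g : presented_group) : word X :=
  repr (g : {eq_quot pres_equiv}).

Lemma pres_reprK g : pres_class (pres_repr g) = g.
Proof. exact: (@reprK _ {eq_quot pres_equiv}). Qed.

Lemma pres_classP u v : pres_class u = pres_class v <-> pres_cong rels u v.
Proof.
split=> [/eqmodP /asboolP //|uv].
by apply/eqmodP; apply/asboolP.
Qed.

Lemma pres_repr_class u : pres_cong rels (pres_repr (pres_class u)) u.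
Proof. by apply/pres_classP; rewrite pres_reprK. Qed.

Lemma winvK : involutive (@winv X).
Proof.
move=> w; rewrite /winv map_rev revK -map_comp -[RHS]map_id.
by apply: eq_map => -[x b] /=; rewrite negbK.
Qed.

Lemma pres_cong_winvr w : pres_cong rels (w ++ winv w) [::].
Proof.
elim: w => [|[x b] w IHw]; first exact: PresRefl.
rewrite /winv map_cons rev_cons -cats1 -/(winv w) /= catA.
apply: (PresTrans (v := [:: (x, b)] ++ [:: (x, ~~ b)])); last exact: PresCancel.
rewrite -cat1s; apply: PresCat; first exact: PresRefl.
exact: (PresCat IHw (PresRefl _ _)).
Qed.

Lemma pres_cong_winvl w : pres_cong rels (winv w ++ w) [::].
Proof. by rewrite -{2}(winvK w); exact: pres_cong_winvr. Qed.

Lemma pres_cong_winv u v :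
  pres_cong rels u v -> pres_cong rels (winv u) (winv v).
Proof.
move=> uv; apply: (PresTrans (v := winv u ++ (v ++ winv v))).
  rewrite -{1}[winv u]cats0; apply: PresCat; first exact: PresRefl.
  exact/PresSym/pres_cong_winvr.
rewrite catA -[X in pres_cong _ _ X]cat0s; apply: PresCat; last exact: PresRefl.
apply: PresTrans (pres_cong_winvl u).
by apply: PresCat; [exact: PresRefl | exact: PresSym].
Qed.

Definition pres_one : presented_group := pres_class [::].
Definition pres_mul (g h : presented_group) : presented_group :=
  pres_class (pres_repr g ++ pres_repr h).
Definition pres_inv (g : presented_group) : presented_group :=
  pres_class (winv (pres_repr g)).

Lemma pres_mul_class u v :
  pres_mul (pres_class u) (pres_class v) = pres_class (u ++ v).
Proof. by apply/pres_classP; apply: PresCat; exact: pres_repr_class. Qed.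

Lemma pres_inv_class u : pres_inv (pres_class u) = pres_class (winv u).
Proof. by apply/pres_classP; apply: pres_cong_winv; exact: pres_repr_class. Qed.

Lemma pres_mulA : associative pres_mul.
Proof.
move=> g h k; rewrite -(pres_reprK g) -(pres_reprK h) -(pres_reprK k).
by rewrite !pres_mul_class catA.
Qed.

Lemma pres_mul1g : left_id pres_one pres_mul.
Proof. by move=> g; rewrite -(pres_reprK g) pres_mul_class. Qed.

Lemma pres_mulg1 : right_id pres_one pres_mul.
Proof. by move=> g; rewrite -(pres_reprK g) pres_mul_class cats0. Qed.

Lemma pres_mulVg : left_inverse pres_one pres_inv pres_mul.
Proof.
move=> g; rewrite -(pres_reprK g) pres_inv_class pres_mul_class.
by apply/pres_classP; exact: pres_cong_winvl.
Qed.

Lemma pres_mulgV : right_inverse pres_one pres_inv pres_mul.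
Proof.
move=> g; rewrite -(pres_reprK g) pres_inv_class pres_mul_class.
by apply/pres_classP; exact: pres_cong_winvr.
Qed.

HB.instance Definition _ :=
  isGroup.Build presented_group
    pres_mulA pres_mul1g pres_mulg1 pres_mulVg pres_mulgV.

End PresentedGroup.

Definition subgroup (G : groupType) (H : set G) : Prop :=
  [/\ H 1%g, forall x y, H x -> H y -> H (x * y)%g & forall x, H x -> H x^-1%g].

Section GeneratedGroup.
Variables (G : groupType) (B : set G).

Definition gen_pred : {pred G} := [pred x | `[< smallest (@subgroup G) B x >]].

Lemma gen_pred_closed : group_closed gen_pred.
Proof.
split; first by apply/asboolP => H [[]].
move=> x y /asboolP Hx /asboolP Hy; apply/asboolP => H HB.
have [[_ HM HV] _] := HB.
by apply: HM; [exact: Hx | apply: HV; exact: Hy].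
Qed.

Definition generated_group : Type := {x : G | gen_pred x}.

HB.instance Definition _ := SubChoice.on generated_group.
HB.instance Definition _ :=
  SubChoice_isSubGroup.Build G gen_pred generated_group gen_pred_closed.

End GeneratedGroup.

Section LinearAut.
Variables (K : fieldType) (V : vectType K).

Definition aut_pred : pred 'End(V) := fun f => lker f == 0%VS.

Definition linear_aut : Type := {f : 'End(V) | aut_pred f}.

HB.instance Definition _ := SubChoice.on linear_aut.

Fact aut_one_subproof : lker (\1%VF : 'End(V)) == 0%VS.
Proof. by apply/lker0P => x y; rewrite !id_lfunE. Qed.

Fact aut_mul_subproof (f g : linear_aut) : lker (val f \o val g)%VF == 0%VS.
Proof.
have /lker0P f_inj := valP f; have /lker0P g_inj := valP g.
by apply/lker0P => x y; rewrite !comp_lfunE => /f_inj /g_inj.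
Qed.

Fact aut_inv_subproof (f : linear_aut) : lker ((val f)^-1)%VF == 0%VS.
Proof.
apply/lker0P => x y eq_xy.
by rewrite -(lker0_lfunVK (valP f) x) eq_xy (lker0_lfunVK (valP f)).
Qed.

Definition aut_one : linear_aut := exist aut_pred _ aut_one_subproof.
Definition aut_mul (f g : linear_aut) : linear_aut :=
  exist aut_pred _ (aut_mul_subproof f g).
Definition aut_inv (f : linear_aut) : linear_aut :=
  exist aut_pred _ (aut_inv_subproof f).

Lemma aut_mulA : associative aut_mul.
Proof. by move=> f g h; apply: val_inj; rewrite /= comp_lfunA. Qed.

Lemma aut_mul1g : left_id aut_one aut_mul.
Proof. by move=> f; apply: val_inj; rewrite /= comp_lfun1l. Qed.

Lemma aut_mulg1 : right_id aut_one aut_mul.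
Proof. by move=> f; apply: val_inj; rewrite /= comp_lfun1r. Qed.

Lemma aut_mulVg : left_inverse aut_one aut_inv aut_mul.
Proof. by move=> f; apply: val_inj; exact: (lker0_compVf (valP f)). Qed.

Lemma aut_mulgV : right_inverse aut_one aut_inv aut_mul.
Proof. by move=> f; apply: val_inj; exact: (lker0_compfV (valP f)). Qed.

HB.instance Definition _ :=
  isGroup.Build linear_aut aut_mulA aut_mul1g aut_mulg1 aut_mulVg aut_mulgV.

End LinearAut.

Definition additive_subgroup (A : zmodType) (H : set A) : Prop :=
  [/\ H 0, forall a b, H a -> H b -> H (a + b) & forall a, H a -> H (- a)].

Definition zspan (A : zmodType) (B : set A) : set A :=
  smallest (@additive_subgroup A) B.

Definition setadd (A : zmodType) (B C : set A) : set A :=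
  [set b + c | b in B & c in C].

(* [b] restricted to the indices satisfying [P] is a Z-basis of [L]. *)
Definition is_zbasis (A : zmodType) (I : finType) (P : pred I) (b : I -> A)
    (L : set A) : Prop :=
  [/\ forall i, P i -> L (b i),
      forall a, L a -> exists c : I -> int, a = \sum_(i | P i) b i *~ c i
    & forall c : I -> int, \sum_(i | P i) b i *~ c i = 0 ->
        forall i, P i -> c i = 0].

Definition free_abelian_of_rank (A : zmodType) (n : nat) (L : set A) : Prop :=
  exists b : 'I_n -> A, is_zbasis xpredT b L.

(* [(b, a^vee)] *)
Definition pairing_coroot (F : fieldType) (T : Type) (form : T -> T -> F)
    (b a : T) : F :=
  if form a a == 0 then 0 else 2 * form b a / form a a.

Section AffineReflectionSystem.
Variables (A : zmodType) (form : A -> A -> rat).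

Record psd_form : Prop := PsdForm {
  psd_sym : forall a b, form a b = form b a;
  psd_additive : forall a b c, form (a + b) c = form a c + form b c;
  psd_ge0 : forall a, 0 <= form a a;
  psd_nontrivial : exists a b, form a b != 0
}.

Definition radical : set A := [set a | forall b, form a b = 0].

Definition anisotropic (B : set A) : set A := B `\` radical.
Definition isotropic (B : set A) : set A := B `&` radical.

Variable R : set A.

Record affine_reflection_system : Prop := AffineReflectionSystem {
  ars_form : psd_form;
  ars_opp : [set - a | a in R] = R;
  ars_span : zspan R = setT;
  ars_string : forall a b, anisotropic R a -> R b ->
    exists d u : nat,
      [set b + a *~ n | n in [set: int]] `&` R =
        [set b + a *~ n | n in [set n : int | - d%:Z <= n <= u%:Z]]
      /\ d%:R - u%:R = pairing_coroot form b a
}.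

Definition irreducible_system : Prop :=
  ~ exists R1 R2 : set A,
      [/\ R1 `|` R2 = anisotropic R, R1 `&` R2 = set0, R1 !=set0, R2 !=set0
        & forall a b, R1 a -> R2 b -> form a b = 0].

Definition tame : Prop :=
  isotropic R `<=` [set a - b | a in anisotropic R & b in anisotropic R].

(* The image of [R] in [A / A^0] is [{0, e, - e}] with [e] nonzero: an element
   [c] is congruent to an element of [R] modulo the radical if and only if it
   is congruent to one of [0], [e], [- e]. *)
Definition type_A1 : Prop :=
  exists2 e, ~ radical e &
    forall c, (exists2 r, R r & radical (c - r)) <->
              [\/ radical c, radical (c - e) | radical (c + e)].

Record ears_A1 (nu : nat) : Prop := EarsA1 {
  ears_ars : affine_reflection_system;
  ears_irreducible : irreducible_system;
  ears_tame : tame;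
  ears_type_A1 : type_A1;
  ears_nullity : free_abelian_of_rank nu radical
}.

Variables (nu m : nat) (eps : A) (S : set A) (tau : 'I_m.+1 -> A).

Record A1_description : Prop := A1Description {
  A1_eps_norm : form eps eps = 2;
  A1_decomp : forall a, exists! n : int, radical (a - eps *~ n);
  A1_S_sub : S `<=` radical;
  A1_S0 : S 0;
  A1_S_stable : forall s t, S s -> S t -> S (s + t *+ 2) /\ S (s - t *+ 2);
  A1_S_span : zspan S = radical;
  A1_roots : R = setadd S S `|` setadd [set 0; eps; - eps] S
}.

(* [sigma_i = tau_i] for the indices [i] in [1..nu]. *)
Definition sigma_index : pred 'I_m.+1 := [pred i : 'I_m.+1 | 0 < i <= nu]%N.

Record coset_description : Prop := CosetDescription {
  coset_cover : S = [set s | exists i, exists2 l, radical l & s = tau i + l *+ 2];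
  coset_tau0 : tau ord0 = 0;
  coset_distinct : forall i j l, radical l -> tau i - tau j = l *+ 2 -> i = j;
  coset_nu_le : (nu <= m)%N;
  coset_basis : is_zbasis sigma_index tau radical
}.

Definition refl_base_root (k : 'I_m.+1) : A := eps + tau k.

Definition refl_base : set A := range refl_base_root.

Definition is_supp (a : A) (I : {set 'I_m.+1}) : Prop :=
  {subset I <= sigma_index} /\
  exists2 l, radical l &
    a = eps + \sum_(i in I) tau i + l *+ 2 \/
    a = - eps + \sum_(i in I) tau i + l *+ 2.

(* The default value is only used outside of the anisotropic roots, where
   supports are not defined. *)
Definition supp (a : A) : {set 'I_m.+1} := xget finset.set0 (is_supp a).

Definition elliptic_like : Prop := forall a, refl_base a -> (#|supp a| <= 2)%N.

Local Notation x := (@wgen 'I_m.+1).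

Inductive hyp_relator : set (word 'I_m.+1) :=
| RelInvol (k : 'I_m.+1) : hyp_relator (x k ++ x k)
| RelSupp (k i j s : 'I_m.+1) : (0 < i)%N -> (i < j <= nu)%N -> (nu < s)%N ->
    [set i; j]%SET = supp (refl_base_root s) ->
    hyp_relator (wcomm (x k) (x s ++ x i ++ x ord0 ++ x j))
| RelNonSupp (k i j : 'I_m.+1) : (0 < i)%N -> (i < j <= nu)%N ->
    ~ [set supp a | a in refl_base] [set i; j]%SET ->
    hyp_relator (wcomm (x k) ((x i ++ x ord0 ++ x j) ++ (x i ++ x ord0 ++ x j))).

Definition hyp_presentation : groupType := presented_group hyp_relator.

End AffineReflectionSystem.

Section Hyperbolic.
Variables (K : realType) (A : zmodType) (V : vectType K) (iota : {additive A -> V}).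

(* [V], with the map [iota], is the tensor product of [K] and [A] over [Z]. *)
Definition is_scalar_extension : Prop :=
  forall (W : lmodType K) (f : {additive A -> W}),
    exists2 g : {linear V -> W}, (forall a, g (iota a) = f a) &
      forall g' : {linear V -> W}, (forall a, g' (iota a) = f a) -> g' =1 g.

Definition is_linear_span (B : set V) (U : {vspace V}) : Prop :=
  (forall v, B v -> v \in U) /\
  forall U' : {vspace V}, (forall v, B v -> v \in U') -> (U <= U')%VS.

Variable V0 : {vspace V}.

Definition dual_space : vectType K := 'Hom(subvs_of V0, K^o).

Definition hyp_space : vectType K := (V * dual_space)%type.

Variables (form : A -> A -> rat) (eps : A) (hform : hyp_space -> hyp_space -> K).

(* The first three conditions determine [hform] on the summand [V]: there it is
   the extension of [form] by scalars. *)
Record hyperbolic_form : Prop := HyperbolicForm {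
  hform_sym : forall u v, hform u v = hform v u;
  hform_linear : forall u, scalar (hform u);
  hform_form : forall a b, hform (iota a, 0) (iota b, 0) = ratr (form a b);
  hform_eps : forall l, hform (iota eps, 0) (0, l) = 0;
  hform_dual : forall l l', hform (0, l) (0, l') = 0;
  hform_eval : forall (v : subvs_of V0) (l : dual_space),
    hform (vsval v, 0) (0, l) = l v
}.

Definition reflection (a b : hyp_space) : hyp_space :=
  b - pairing_coroot hform b a *: a.

Definition hyperbolic_weyl_group (R : set A) : groupType :=
  generated_group
    [set g : linear_aut hyp_space |
      exists2 a, R a & forall b, val g b = reflection (iota a, 0) b].

End Hyperbolic.

(* Main.v *)
(** The reflections in [eps + s] generate the semidirect product of [Z/2] with
    a Heisenberg-type group: the products [T_s] of the reflections in [eps + s]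
    and [eps] satisfy [T_s T_t = T_(s+t) c(s, t)], where [c(s, t)] is the central
    map [l |-> l + l(s) t - l(t) s] of [(V^0)*] into [V^0].  Only the cosets of
    the [tau_k] modulo [2 Lambda] matter for the group, so for [k > nu] we send
    the generator [x_k] to the reflection in [eps + sigma_i + sigma_j], where
    [{i, j}] is the support of [alpha_k]; then [x_k x_i x_0 x_j] acts as
    [c(sigma_i, sigma_j)] and [(x_i x_0 x_j)^2] as its square, so the relators
    hold.  Conversely the relators make one of these two elements central in the
    presented group for every pair [i < j <= nu], and each element takes the form
    [x_0^b z t], where [z] is a product of powers of these central elements and
    [t] an ordered product of powers of the [x_i x_0] with [i <= nu].  The action
    on the hyperbolic space determines [b] and all the exponents. *)

Require Import Defs.
From HB Require Import structures.
From mathcomp Require Import all_boot all_order all_algebra.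
From mathcomp Require Import boolp classical_sets reals.
From mathcomp Require Import ring zify.

Set Implicit Arguments.
Unset Strict Implicit.
Unset Printing Implicit Defensive.

Import Order.TTheory GRing.Theory Num.Theory VectorInternalTheory.

(** * Presented groups *)

Section WordEval.
Variables (X : Type) (H : groupType) (y : X -> H).
Local Open Scope group_scope.

Definition word_eval (w : word X) : H :=
  \prod_(l <- w) (if l.2 then (y l.1)^-1 else y l.1).

Lemma word_eval_cat u v : word_eval (u ++ v) = word_eval u * word_eval v.
Proof. exact: big_cat. Qed.

Lemma word_eval_gen k : word_eval (wgen k) = y k.
Proof. exact: big_seq1. Qed.

Lemma word_eval_winv w : word_eval (winv w) = (word_eval w)^-1.
Proof.
elim: w => [|[k b] w IHw]; first by rewrite /word_eval big_nil invg1.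
rewrite /winv map_cons rev_cons -cats1 word_eval_cat -/(winv w) IHw.
rewrite -[in RHS]cat1s word_eval_cat invgM; congr (_ * _).
by rewrite /word_eval !big_seq1; case: b => //=; rewrite invgK.
Qed.

Lemma word_eval_wcomm u v :
  word_eval (wcomm u v) = 1 <-> commute (word_eval u) (word_eval v).
Proof.
rewrite /wcomm !word_eval_cat !word_eval_winv -invgM mulgA; split=> [/divg1_eq //|->].
exact: mulgV.
Qed.

Lemma word_eval_cong (rels : set (word X)) u v :
  (forall r, rels r -> word_eval r = 1) ->
  pres_cong rels u v -> word_eval u = word_eval v.
Proof.
move=> rels1; elim=> {u v} //.
- by move=> u v w _ -> _ ->.
- by move=> u u' v v' _ eq_u _ eq_v; rewrite !word_eval_cat eq_u eq_v.
- move=> k b; rewrite /word_eval big_cons big_seq1 big_nil /=.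
  by case: b; rewrite (mulVg, mulgV).
- by move=> r /rels1 ->; rewrite /word_eval big_nil.
Qed.

End WordEval.

Section PresentedGroupTheory.
Variables (X : choiceType) (rels : set (word X)).
Local Open Scope group_scope.

Definition pres_gen (k : X) : presented_group rels := pres_class rels (wgen k).

Lemma pres_class_eval w : pres_class rels w = word_eval pres_gen w.
Proof.
elim: w => [|[k b] w IHw]; first by rewrite /word_eval big_nil.
rewrite -cat1s word_eval_cat -IHw -pres_mul_class; congr (_ * _).
by rewrite /word_eval big_seq1; case: b => //=; rewrite [RHS]pres_inv_class.
Qed.

Lemma pres_gen_rel r : rels r -> word_eval pres_gen r = 1.
Proof. by move=> rels_r; rewrite -pres_class_eval; apply/pres_classP/PresRel. Qed.

Lemma pres_group_ind (P : presented_group rels -> Prop) :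
    P 1 -> (forall k g, P g -> P (pres_gen k * g)) ->
    (forall k g, P g -> P ((pres_gen k)^-1 * g)) ->
  forall g, P g.
Proof.
move=> P1 Pgen PgenV g; rewrite -(pres_reprK g) pres_class_eval.
elim: (pres_repr g) => [|[k b] w IHw]; first by rewrite /word_eval big_nil.
by rewrite /word_eval big_cons; case: b; [apply: PgenV | apply: Pgen].
Qed.

(** Von Dyck's theorem: evaluating a chosen representative word gives a homomorphism because
    evaluation is constant on congruence classes. *)
Lemma pres_group_lift (H : groupType) (y : X -> H) :
    (forall r, rels r -> word_eval y r = 1) ->
  exists f : UMagmaMorphism.type (presented_group rels) H,
    forall k, f (pres_gen k) = y k.
Proof.
move=> y_rels; pose f (g : presented_group rels) := word_eval y (pres_repr g).
have fE w : f (pres_class rels w) = word_eval y w.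
  by apply: word_eval_cong y_rels _; apply: pres_repr_class.
have fM : {morph f : g h / g * h}.
  by move=> g h; rewrite [LHS]fE word_eval_cat.
have f1 : f 1 = 1 by rewrite [LHS]fE /word_eval big_nil.
pose fm := isUMagmaMorphism.Build _ _ f (f1, fM).
exists (HB.pack f fm : UMagmaMorphism.type (presented_group rels) H) => k.
by rewrite /= fE word_eval_gen.
Qed.

End PresentedGroupTheory.

Lemma isomorphic_of_bijective (G H : groupType) (f : {multiplicative G -> H}) :
  bijective f -> isomorphic H G.
Proof.
case=> g fK gK.
have gM : {morph g : x y / (x * y)%g} by apply: can2_gmulfM.
pose gm := isMultiplicative.Build _ _ g gM.
by exists (HB.pack g gm : {multiplicative H -> G}); exists f.
Qed.

(** * Normal forms *)

Section IntegerPowers.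
Variable G : groupType.
Implicit Types (g h : G) (n k : int).
Local Open Scope group_scope.

Definition intexp g n : G :=
  match n with Posz k => g ^+ k | Negz k => g ^- k.+1 end.

Lemma intexpS g n : intexp g (1 + n)%R = g * intexp g n.
Proof.
case: n => [n|[|n]]; first by rewrite -PoszD /= -expgS.
  by rewrite /= mulgV.
rewrite NegzE -addn1 PoszD opprD addrCA subrr addr0 -NegzE /= addn0.
  by rewrite (expgSr g n.+1) invgM mulVKg.
Qed.

Lemma intexpD g n k : intexp g (n + k)%R = intexp g n * intexp g k.
Proof.
elim: n => [|n IHn|n IHn]; first by rewrite add0r mul1g.
  by rewrite -[n.+1]add1n PoszD -addrA !intexpS IHn mulgA.
apply: (mulgI g); rewrite mulgA -!intexpS addrA.
by rewrite -[n.+1]add1n PoszD opprD addrA subrr add0r.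
Qed.

Lemma intexp1 g : intexp g 1 = g.
Proof. by []. Qed.

Lemma intexpN1 g : intexp g (-1) = g^-1.
Proof. by []. Qed.

End IntegerPowers.

Section CommutingModulo.
Variables (G : groupType) (N : set G).
Hypothesis N_subgroup : subgroup N.
Hypothesis N_central : forall z g, N z -> commute z g.
Local Open Scope group_scope.

(** Commutation in the quotient by [N], expressed without forming that quotient. *)
Definition commute_mod g h : Prop := exists2 z, N z & g * h = z * (h * g).

Lemma commute_modM (g h k : G) :
  commute_mod g h -> commute_mod g k -> commute_mod g (h * k).
Proof.
have [_ NM _] := N_subgroup; move=> [z Nz gh] [w Nw gk].
exists (z * w); first exact: NM.
by rewrite mulgA gh -!mulgA gk; congr (_ * _); rewrite !mulgA (N_central h Nw).
Qed.

Lemma commute_mod_sym g h : commute_mod g h -> commute_mod h g.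
Proof.
have [_ _ NV] := N_subgroup; move=> [z Nz gh]; exists z^-1; first exact: NV.
by rewrite gh mulKg.
Qed.

Lemma commute_modV g h : commute_mod g h -> commute_mod g h^-1.
Proof.
have [_ _ NV] := N_subgroup; move=> [z Nz gh]; exists z^-1; first exact: NV.
apply: (mulIg h); rewrite mulgVK -!mulgA gh.
by rewrite (mulgA h^-1 z) -(N_central h^-1 Nz) -mulgA mulKg mulKg.
Qed.

Lemma commute_mod_intexp g h n : commute_mod g h -> commute_mod g (intexp h n).
Proof.
have [N1 _ _] := N_subgroup; move=> gh.
have ghX (k : nat) : commute_mod g (h ^+ k).
  elim: k => [|k IHk]; first by exists 1; rewrite ?mulg1 ?mul1g.
  by rewrite expgS; apply: commute_modM.
by case: n => k; [|apply: commute_modV]; apply: ghX.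
Qed.

Variables (I : eqType) (a : I -> G).

Definition intprod (r : seq I) (c : I -> int) : G :=
  \prod_(i <- r) intexp (a i) (c i).

(** Collection process: the power travels right past the earlier factors of the ordered product
    until it meets its own, and each exchange costs only a central element of [N]. *)
Lemma intprod_mul (r : seq I) (c : I -> int) (i : I) (n : int) :
    uniq r -> {in r &, forall j k, commute_mod (a j) (a k)} -> i \in r ->
  exists2 z, N z & intexp (a i) n * intprod r c =
    z * intprod r (fun j => if j == i then (n + c j)%R else c j).
Proof.
have [N1 NM _] := N_subgroup.
elim: r => // j r IHr /= /andP[r'j uniq_r] comm_r.
rewrite inE /intprod !big_cons; have [-> _|ij /= ir] := eqVneq.
  exists 1 => //=; rewrite mul1g intexpD -!mulgA; congr (_ * (_ * _)).
  by apply: eq_big_seq => k rk; rewrite ifN //; apply: contraNneq r'j => <-.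
have [] := IHr uniq_r _ ir.
  by move=> k l rk rl; apply: comm_r; rewrite inE (rk, rl) orbT.
move=> z Nz; rewrite -/(intprod _ _) => IH.
have [w Nw ijw] : commute_mod (intexp (a i) n) (intexp (a j) (c j)).
  apply/commute_mod_intexp/commute_mod_sym/commute_mod_intexp.
  by apply: comm_r; rewrite inE ?eqxx ?ir ?orbT.
exists (w * z); first exact: NM.
rewrite mulgA ijw -!mulgA IH; congr (_ * _).
by rewrite !mulgA -/(intprod _ _); congr (_ * _); rewrite (N_central _ Nz).
Qed.

Lemma intprod0 r : intprod r (fun _ => 0%R) = 1.
Proof. exact: big1_eq. Qed.

End CommutingModulo.

Section IntprodMorphism.
Variables (G : groupType) (A : zmodType) (P : G -> A -> Prop).
Hypothesis P1 : P 1%g 0%R.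
Hypothesis PM : forall g h a b, P g a -> P h b -> P (g * h)%g (a + b)%R.
Hypothesis PV : forall g a, P g a -> P g^-1%g (- a)%R.

Lemma rel_intexp g a n : P g a -> P (intexp g n) (a *~ n)%R.
Proof.
move=> Pg; have PX (k : nat) : P (g ^+ k)%g (a *+ k)%R.
  by elim: k => // k IHk; rewrite expgS mulrS; apply: PM.
by case: n => k; rewrite ?NegzE ?mulrNz; [|apply: PV]; apply: PX.
Qed.

(** A relation compatible with the group operations takes the place of a homomorphism because the
    invariants used later, [shifts] and [fiber_shift], are relations. *)
Lemma rel_intprod (I : eqType) (g : I -> G) (a : I -> A) (r : seq I) c :
    {in r, forall i, P (g i) (a i)} ->
  P (intprod g r c) (\sum_(i <- r) a i *~ c i)%R.
Proof.
elim: r => [|i r IHr] Pr; first by rewrite /intprod !big_nil.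
rewrite /intprod !big_cons; apply: PM.
  by apply/rel_intexp/Pr; rewrite inE eqxx.
by apply: IHr => j rj; apply: Pr; rewrite inE rj orbT.
Qed.

End IntprodMorphism.

(** * Normal form modulo central commutators *)

Section EllipticNormalForm.
Variables (m nu : nat) (G : groupType) (x : 'I_m.+1 -> G).
Variable z : 'I_m.+1 * 'I_m.+1 -> G.
Local Open Scope group_scope.

Definition ordered_pair : pred ('I_m.+1 * 'I_m.+1) :=
  [pred p : 'I_m.+1 * 'I_m.+1 | (0 < p.1)%N && (p.1 < p.2 <= nu)%N].

Definition transl (i : 'I_m.+1) : G := x i * x ord0.

Hypothesis x_invol : forall k, x k * x k = 1.
Hypothesis z_central : forall p g, commute (z p) g.
Hypothesis triple_sq : forall p, ordered_pair p ->
  exists n : nat, (x p.1 * x ord0 * x p.2) ^+ 2 = z p ^+ n.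
Hypothesis x_gt_nu : forall s : 'I_m.+1, (nu < s)%N ->
  exists2 p, ordered_pair p & x s = z p * (x p.2 * x ord0 * x p.1).

Let zprod := intprod z (enum {: 'I_m.+1 * 'I_m.+1}).
Let tprod := intprod transl (enum (@sigma_index nu m)).
Let N : set G := [set h | exists d, h = zprod d]%classic.

Lemma x_cancel k g : x k * (x k * g) = g.
Proof. by rewrite mulgA x_invol mul1g. Qed.

Lemma intexp_central p n g : commute (intexp (z p) n) g.
Proof.
by apply: commute_sym; case: n => k; rewrite /intexp;
  [|apply: commuteV]; apply/commuteX/commute_sym/z_central.
Qed.

Lemma zprod_central d g : commute (zprod d) g.
Proof.
rewrite /zprod /intprod; elim/big_ind: _ => //.
- exact/commute_sym/commute1.
- by move=> u v ug vg; apply/commute_sym/commuteM; apply: commute_sym.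
- by move=> p _; apply: intexp_central.
Qed.

Lemma zprodD d d' : zprod d * zprod d' = zprod (fun p => (d p + d' p)%R).
Proof.
rewrite /zprod /intprod -prodgM_commute; last first.
  by move=> p q _ _; apply: intexp_central.
by apply: eq_bigr => p _; rewrite intexpD.
Qed.

Lemma zprod_subgroup : subgroup N.
Proof.
split; first by exists (fun=> 0%R); rewrite [zprod _]intprod0.
  by move=> _ _ [d ->] [d' ->]; rewrite zprodD; eexists.
move=> _ [d ->]; exists (fun p => - d p)%R; apply: mulg1_eq.
rewrite zprodD -[RHS](intprod0 z (enum {: 'I_m.+1 * 'I_m.+1})).
by apply: eq_bigr => p _; rewrite subrr.
Qed.

Lemma N_central h g : N h -> commute h g.
Proof. by move=> [d ->]; apply: zprod_central. Qed.

Lemma intexp_N p n : N (intexp (z p) n).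
Proof.
(* The [z p] commute exactly, so the collection lemma applies with the trivial subgroup in place of
   [N], starting from exponents all zero. *)
have one_subgroup : subgroup [set 1 : G]%classic.
  by split=> [|_ _ -> ->|_ ->] //=; rewrite ?mulg1 ?invg1.
have one_central h g : [set 1 : G]%classic h -> commute h g.
  by move=> ->; apply/commute_sym/commute1.
have [||_ ->] := intprod_mul one_subgroup one_central (a := z) (fun=> 0%R) n
  (enum_uniq {: 'I_m.+1 * 'I_m.+1}) _ (i := p).
- by move=> q q' _ _; exists 1; rewrite // mul1g; apply: z_central.
- by rewrite mem_enum.
by rewrite intprod0 mulg1 mul1g => ->; eexists.
Qed.

(** The commutator of [transl i] and [transl j] is [(x i * x ord0 * x j) ^+ 2], since two adjacent
    copies of [x ord0] cancel; [triple_sq] makes it a power of the central [z (i, j)]. *)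
Lemma transl_commute_mod i j : i \in @sigma_index nu m -> j \in @sigma_index nu m ->
  commute_mod N (transl i) (transl j).
Proof.
wlog lt_ij : i j / (i < j)%N => [Hwlog | iP jP].
  case: (ltngtP i j) => [lt_ij|lt_ji|/val_inj ->] iP jP; first exact: Hwlog.
    exact/(commute_mod_sym zprod_subgroup)/Hwlog.
  by exists 1; [apply: (intexp_N (i, i) 0) | rewrite mul1g].
have pij : ordered_pair (i, j).
  by case/andP: iP => i_gt _; case/andP: jP => _ j_le; apply/and3P.
have [n /= tr_n] := triple_sq pij; exists (z (i, j) ^+ n); first exact: (intexp_N _ n).
by rewrite -tr_n /transl expg2 -!mulgA !x_cancel.
Qed.

Let nf g := exists (b : bool) h c, N h /\ g = x ord0 ^+ b * (h * tprod c).

Lemma nf_x0 g : nf g -> nf (x ord0 * g).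
Proof.
move=> [b [h [c [Nh ->]]]]; exists (~~ b), h, c; split=> //; rewrite mulgA.
by case: b; rewrite ?expg1 ?expg0 ?x_invol ?mulg1.
Qed.

Lemma nf_N h g : N h -> nf g -> nf (h * g).
Proof.
have [_ NM _] := zprod_subgroup.
move=> Nh [b [k [c [Nk ->]]]]; exists b, (h * k), c; split; first exact: NM.
by rewrite mulgA (N_central (x ord0 ^+ b) Nh) -!mulgA.
Qed.

Lemma nf_tprod i n c : i \in @sigma_index nu m -> nf (intexp (transl i) n * tprod c).
Proof.
move=> iP; have [||h Nh ->] :=
  intprod_mul zprod_subgroup N_central (a := transl) c n
    (enum_uniq (@sigma_index nu m)) _ _ (i := i).
- by move=> j k; rewrite !mem_enum; apply: transl_commute_mod.
- by rewrite mem_enum.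
by exists false, h; eexists; rewrite expg0 mul1g; split.
Qed.

(** Conjugation by [x ord0] inverts [transl i], so this factor passes a leading [x ord0] with
    exponent -1, and keeps exponent 1 if there is none. *)
Lemma nf_transl i g : i \in @sigma_index nu m -> nf g -> nf (transl i * g).
Proof.
move=> iP [b [h [c [Nh ->]]]].
suff [n ->] : exists n, transl i * (x ord0 ^+ b * (h * tprod c)) =
    x ord0 ^+ b * (h * (intexp (transl i) n * tprod c)).
  by case: b; rewrite ?expg0 ?mul1g; [apply: nf_x0|]; apply: (nf_N Nh);
    apply: nf_tprod.
case: b; last first.
  by exists 1%R; rewrite !expg0 !mul1g intexp1 (mulgA h) (N_central (transl i) Nh);
    apply: mulgA.
exists (-1)%R; rewrite intexpN1 expg1 (mulgA h) (N_central (transl i)^-1 Nh).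
by rewrite /transl invgM -!mulgA x_cancel mulVKg (mulg1_eq (x_invol i)).
Qed.

Lemma nf_sigma i g : i \in @sigma_index nu m -> nf g -> nf (x i * g).
Proof.
move=> iP nf_g; have -> : x i * g = transl i * (x ord0 * g).
  by rewrite /transl -mulgA x_cancel.
by apply/nf_transl/nf_x0.
Qed.

(** Left multiplication by every generator preserves normal forms. The assumption on [g] is
    induction over positive words, enough for a group generated by involutions. *)
Lemma elliptic_normal_form g :
    (forall P : G -> Prop, P 1 -> (forall k h, P h -> P (x k * h)) -> P g) ->
  exists (b : bool) d c, g = x ord0 ^+ b * (zprod d * tprod c).
Proof.
move=> gen_g; suff [b [_ [c [[d ->] ->]]]] : nf g by exists b, d, c.
apply: gen_g => [|k h nf_h].
  exists false, 1, (fun=> 0%R); split; first by have [] := zprod_subgroup.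
  by rewrite expg0 !mul1g [tprod _]intprod0.
have [s_gt|s_le] := ltnP nu k; last first.
  have [k0|k_gt] := posnP k; last by apply: nf_sigma => //; apply/andP.
  by rewrite (_ : k = ord0) ?(inj_eq val_inj); [apply: nf_x0 | apply: val_inj].
(* A generator beyond [nu] is a central element times three generators already treated. *)
have [[i j] /= pij ->] := x_gt_nu s_gt.
move/and3P: (pij) => /= [i_gt lt_ij j_le].
have iP : i \in @sigma_index nu m by apply/andP; split=> //; apply/ltnW/(leq_trans lt_ij).
have jP : j \in @sigma_index nu m by apply/andP; split=> //; apply: leq_ltn_trans lt_ij.
rewrite -!mulgA; apply: nf_N; first exact: (intexp_N _ 1).
by apply: nf_sigma => //; apply: nf_x0; apply: nf_sigma.
Qed.

End EllipticNormalForm.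

Local Open Scope ring_scope.

(** * Supports and cosets *)

Lemma int_parity (c : int) : exists (b : bool) (q : int), c = b%:Z + q * 2.
Proof.
have /orP c2 : ((c %% 2)%Z == 0) || ((c %% 2)%Z == 1).
  by have := modz_ge0 c (isT : 2 != 0 :> int); have := ltz_mod c (isT : 2 != 0 :> int); lia.
case: c2 => /eqP c2; [exists false|exists true]; exists (c %/ 2)%Z;
  by rewrite addrC {1}(divz_eq c 2) c2.
Qed.

Section Supports.
Variables (A : zmodType) (form : A -> A -> rat).
Variables (R : set A) (nu m : nat) (eps : A) (S : set A) (tau : 'I_m.+1 -> A).
Hypothesis form_psd : psd_form form.
Hypothesis R_desc : A1_description form R eps S.
Hypothesis S_desc : coset_description form nu S tau.
Hypothesis elliptic : elliptic_like form nu eps tau.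

Lemma radical0 : radical form 0.
Proof.
move=> b; have := psd_additive form_psd 0 0 b.
by rewrite addr0 => form0; apply: (addrI (form 0 b)); rewrite -form0 addr0.
Qed.

Lemma radicalD s t : radical form s -> radical form t -> radical form (s + t).
Proof. by move=> rs rt b; rewrite (psd_additive form_psd) rs rt addr0. Qed.

Lemma formN a b : form (- a) b = - form a b.
Proof.
by apply/eqP; rewrite -addr_eq0 -(psd_additive form_psd) addNr radical0.
Qed.

Lemma radicalN s : radical form s -> radical form (- s).
Proof. by move=> rs b; rewrite formN rs oppr0. Qed.

Lemma radicalB s t : radical form s -> radical form t -> radical form (s - t).
Proof. by move=> rs rt; apply/radicalD/radicalN. Qed.

Lemma radicalMn s n : radical form s -> radical form (s *+ n).
Proof.
move=> rs; elim: n => [|n IHn]; first exact: radical0.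
by rewrite mulrS; apply: radicalD.
Qed.

Lemma radicalMz s n : radical form s -> radical form (s *~ n).
Proof.
by move=> rs; case: n => n; rewrite ?NegzE ?mulrNz; [|apply: radicalN]; apply: radicalMn.
Qed.

Lemma radical_sum (I : Type) (r : seq I) (P : pred I) (F : I -> A) :
  (forall i, P i -> radical form (F i)) -> radical form (\sum_(i <- r | P i) F i).
Proof. by move=> rF; elim/big_ind: _ => //; [apply: radical0 | apply: radicalD]. Qed.

Lemma S_coset s l : S s -> radical form l -> S (s + l *+ 2).
Proof.
rewrite (coset_cover S_desc) => -[i [k rk ->]] rl.
exists i, (k + l); first exact: (radicalD rk rl).
by rewrite mulrnDl [RHS]addrA.
Qed.

Lemma tau_S i : S (tau i).
Proof.
rewrite (coset_cover S_desc); exists i, 0; first exact: radical0.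
by rewrite mul0rn addr0.
Qed.

Lemma tau_radical i : radical form (tau i).
Proof. exact/(A1_S_sub R_desc)/tau_S. Qed.

(** Comparing coefficients in the Z-basis modulo 2 separates the indicator functions of [I] and
    [J]. *)
Lemma subset_sum_inj (I J : {set 'I_m.+1}) l :
    {subset I <= @sigma_index nu m} -> {subset J <= @sigma_index nu m} ->
    radical form l ->
    \sum_(i in I) tau i = \sum_(i in J) tau i + l *+ 2 ->
  I = J.
Proof.
have [_ tau_span tau_free] := coset_basis S_desc.
move=> sI sJ /tau_span[c ->] eqIJ.
have indicator (B : {set 'I_m.+1}) : {subset B <= @sigma_index nu m} ->
    \sum_(i in B) tau i = \sum_(i | @sigma_index nu m i) tau i *~ (i \in B)%:Z.
  move=> sB; rewrite [LHS]big_mkcond [RHS]big_mkcond; apply: eq_bigr => i _.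
  by case: ifPn => [/sB iP|_]; rewrite ?mulr0z ?if_same // [RHS]ifT // mulr1z.
move: eqIJ; rewrite !indicator // -sumrMnl -big_split /=.
move/eqP; rewrite -subr_eq0 -sumrB => /eqP sum0.
apply/setP => i; have [iP|/negP iP] := boolP (@sigma_index nu m i); last first.
  by apply/idP/idP => [/sI|/sJ].
have c_sum0 : \sum_(i | @sigma_index nu m i)
    tau i *~ ((i \in I)%:Z - ((i \in J)%:Z + (c i + c i))) = 0.
  by rewrite -[RHS]sum0; apply: eq_bigr => j _; rewrite mulrzBr !mulrzDr mulr2n.
have := tau_free _ c_sum0 i iP.
by case: (i \in I); case: (i \in J) => // /eqP; lia.
Qed.

(** [I] collects the basis vectors whose coefficient in [s] is odd. *)
Lemma subset_sum_exists s : radical form s ->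
  exists I : {set 'I_m.+1}, {subset I <= @sigma_index nu m} /\
    exists2 l, radical form l & s = \sum_(i in I) tau i + l *+ 2.
Proof.
have [_ tau_span _] := coset_basis S_desc => /tau_span[c ->].
have [b c_b] := choice (fun i => int_parity (c i)).
have [q c_q] := choice c_b.
exists [set i | @sigma_index nu m i && b i]; split.
  by move=> i; rewrite inE => /andP[].
exists (\sum_(i | @sigma_index nu m i) tau i *~ q i).
  by apply: radical_sum => i _; apply/radicalMz/tau_radical.
rewrite [X in X + _](eq_bigl (fun i => @sigma_index nu m i && b i));
  last by move=> i; rewrite inE.
rewrite [X in _ = X + _]big_mkcondr -sumrMnl -big_split /=; apply: eq_bigr => i _.
rewrite c_q mulrzDr mulrzA; congr (_ + _).
by case: (b i).
Qed.

Let root_supp k : {set 'I_m.+1} := supp form nu eps tau (refl_base_root eps tau k).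

Lemma eps_norm_eq2 : form eps eps = 2.
Proof. exact: A1_eps_norm R_desc. Qed.

Lemma root_suppP k : {subset root_supp k <= @sigma_index nu m} /\
  exists2 l, radical form l & tau k = \sum_(i in root_supp k) tau i + l *+ 2.
Proof.
have [I [sI [l rl tau_k]]] := subset_sum_exists (tau_radical k).
have supp_k : exists J, is_supp form nu eps tau (refl_base_root eps tau k) J.
  by exists I; split=> //; exists l => //; left; rewrite /refl_base_root tau_k addrA.
have [sK [l' rl' [|]]] := xgetPex finset.set0 supp_k.
  by rewrite -addrA => /addrI; split=> //; exists l'.
(* [supp] could a priori have been chosen through the alternative with [- eps]. That would put
   [eps *+ 2] in the radical, whereas its form with [eps] is 4. *)
rewrite -/(root_supp k) => eq_neg.
have rad : radical form (\sum_(i in root_supp k) tau i + l' *+ 2 - tau k).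
  apply: radicalB; last exact: tau_radical.
  apply: radicalD; last exact: radicalMn.
  by apply: radical_sum => i _; apply: tau_radical.
suff /(congr1 (form^~ eps)) : eps *+ 2 = \sum_(i in root_supp k) tau i + l' *+ 2 - tau k.
  by rewrite rad mulr2n (psd_additive form_psd) eps_norm_eq2.
apply/eqP; rewrite eq_sym subr_eq mulr2n -addrA -[eps + tau k]/(refl_base_root eps tau k).
by rewrite eq_neg !addrA subrr add0r.
Qed.

Lemma root_supp_eq k (I : {set 'I_m.+1}) : {subset I <= @sigma_index nu m} ->
  tau k = \sum_(i in I) tau i -> root_supp k = I.
Proof.
move=> sI tau_k; have [sK [l rl]] := root_suppP k; rewrite tau_k => eqI.
exact/esym/(subset_sum_inj sI sK rl eqI).
Qed.

Lemma root_supp0 : root_supp ord0 = finset.set0.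
Proof.
apply: root_supp_eq => [i|]; first by rewrite inE.
by rewrite big_set0 (coset_tau0 S_desc).
Qed.

Lemma root_supp_sigma i : @sigma_index nu m i -> root_supp i = [set i]%SET.
Proof.
move=> iP; apply: root_supp_eq => [j|]; last by rewrite big_set1.
by rewrite inE => /eqP ->.
Qed.

Lemma root_supp_inj : injective root_supp.
Proof.
move=> s s' eq_supp; have [_ [l rl tau_s]] := root_suppP s.
have [_ [l' rl' tau_s']] := root_suppP s'.
apply: (coset_distinct S_desc (radicalB rl rl')).
by rewrite tau_s tau_s' eq_supp opprD addrACA subrr add0r mulrnBl.
Qed.

(** Elliptic-likeness bounds the size by 2. Sizes 0 and 1 are excluded by injectivity of supports:
    such supports already belong to index 0 and to the basis indices. *)
Lemma root_supp_gt (s : 'I_m.+1) : (nu < s)%N ->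
  exists2 p, ordered_pair nu p & root_supp s = [set p.1; p.2]%SET.
Proof.
move=> s_gt; have [sK _] := root_suppP s.
have supp_le2 : (#|root_supp s| <= 2)%N by apply: elliptic; exists s.
have : #|root_supp s| != 0%N.
  rewrite cards_eq0 -root_supp0; apply: contraTneq s_gt => /root_supp_inj ->.
  by rewrite -leqNgt.
have : #|root_supp s| != 1%N.
  apply/negP => /cards1P[i eq_s].
  have iP : @sigma_index nu m i by apply: sK; rewrite eq_s set11.
  move: eq_s; rewrite -(root_supp_sigma iP) => /root_supp_inj eq_s.
  by move: s_gt; rewrite ltnNge eq_s; case/andP: iP => _ ->.
have [|/negP] := boolP (#|root_supp s| == 2%N); last by lia.
case/cards2P => i [j [ij eq_s]] _ _.
have {sK} [/andP[i_gt i_le] /andP[j_gt j_le]] :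
    @sigma_index nu m i /\ @sigma_index nu m j.
  by split; apply: sK; rewrite eq_s !inE eqxx ?orbT.
have [ij_lt|ji_lt|/val_inj eq_ij] := ltngtP i j; last by rewrite eq_ij eqxx in ij.
  by exists (i, j) => //; apply/and3P.
by exists (j, i); [apply/and3P | rewrite eq_s finset.setUC].
Qed.

(* [tau k] may be replaced by the sum of the basis vectors in the support of
   [alpha_k], since both lie in the same coset; with this choice of
   representatives the relators of the presentation hold on the nose. *)
Definition std_tau k : A := \sum_(i in root_supp k) tau i.

Lemma std_tau_coset k : exists2 l, radical form l & tau k = std_tau k + l *+ 2.
Proof. by have [_] := root_suppP k. Qed.

Lemma std_tau_S k : S (std_tau k).
Proof.
have [l rl tau_k] := std_tau_coset k.
rewrite -[std_tau k](addrK (l *+ 2)) -tau_k -mulNrn.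
exact/S_coset/radicalN/rl/tau_S.
Qed.

Lemma std_tau0 : std_tau ord0 = 0.
Proof. by rewrite /std_tau root_supp0 big_set0. Qed.

Lemma std_tau_sigma i : @sigma_index nu m i -> std_tau i = tau i.
Proof. by move=> iP; rewrite /std_tau root_supp_sigma // big_set1. Qed.

Lemma std_tau_pair s (i j : 'I_m.+1) : (i < j)%N -> root_supp s = [set i; j]%SET ->
  std_tau s = tau i + tau j.
Proof.
move=> ij eq_s; rewrite /std_tau eq_s big_setU1 ?big_set1 //.
by rewrite inE; apply: contraTneq ij => ->; rewrite ltnn.
Qed.

(** The coordinate is defined on all of [A], not just on the lattice, so that the universal property
    of the scalar extension can carry it to [V]. *)
Lemma lattice_coord p : @sigma_index nu m p ->
  exists f : A -> int, {morph f : a b / a - b} /\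
    forall j, @sigma_index nu m j -> f (tau j) = (j == p)%:Z.
Proof.
move=> pP; have [_ tau_span tau_free] := coset_basis S_desc.
pose comb n (c : 'I_m.+1 -> int) := eps *~ n + \sum_(i | @sigma_index nu m i) tau i *~ c i.
have combB n n' c c' : comb n c - comb n' c' = comb (n - n') (fun i => c i - c' i).
  rewrite /comb opprD addrACA -mulrzBr -sumrB; congr (_ + _).
  by apply: eq_bigr => i _; rewrite mulrzBr.
have comb0 n c : comb n c = 0 -> forall i, @sigma_index nu m i -> c i = 0.
  move=> nc0; have [k [_ uniq_k]] := A1_decomp R_desc 0.
  have rad_sum : radical form (\sum_(i | @sigma_index nu m i) tau i *~ c i).
    by apply: radical_sum => i _; apply/radicalMz/tau_radical.
  (* The radical contains both [0 - eps *~ 0] and, by [nc0], [0 - eps *~ n]; uniqueness in the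
     decomposition identifies the two multiples. *)
  have n0 : n = 0.
    have <- : k = n.
      by apply: uniq_k; rewrite -nc0 /comb addrC addKr.
    by apply: uniq_k; rewrite mulr0z subr0; apply: radical0.
  by apply: tau_free; move: nc0; rewrite /comb n0 mulr0z add0r.
have comb_ex a : exists nc, a = comb nc.1 nc.2.
  have [n [/tau_span[c eq_c] _]] := A1_decomp R_desc a.
  by exists (n, c); rewrite /comb -eq_c addrC subrK.
have [nc a_nc] := choice comb_ex.
have coord_comb n c : (nc (comb n c)).2 p = c p.
  have : comb (nc (comb n c)).1 (nc (comb n c)).2 - comb n c = 0.
    by rewrite -a_nc subrr.
  rewrite combB => /comb0/(_ p pP) /eqP.
  by rewrite subr_eq0 => /eqP.
exists (fun a => (nc a).2 p); split=> [a b|j jP].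
  by rewrite {1}(a_nc a) {1}(a_nc b) combB coord_comb.
have -> : tau j = comb 0 (fun i => (i == j)%:Z).
  rewrite /comb mulr0z add0r (bigD1 j) //= eqxx mulr1z big1 ?addr0 // => i /andP[_ ij].
  by rewrite (negPf ij) mulr0z.
by rewrite coord_comb eq_sym.
Qed.

End Supports.

(** * Reflections of the hyperbolic space *)

Section HyperbolicReflections.
Variables (K : realType) (A : zmodType) (form : A -> A -> rat) (R : set A).
Variables (nu m : nat) (eps : A) (S : set A) (tau : 'I_m.+1 -> A).
Variables (V : vectType K) (iota : {additive A -> V}) (V0 : {vspace V}).
Variable hform : hyp_space V0 -> hyp_space V0 -> K.
Hypothesis form_psd : psd_form form.
Hypothesis R_desc : A1_description form R eps S.
Hypothesis S_desc : coset_description form nu S tau.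
Hypothesis elliptic : elliptic_like form nu eps tau.
Hypothesis iota_ext : is_scalar_extension iota.
Hypothesis V0_span : is_linear_span [set iota s | s in radical form]%classic V0.
Hypothesis hyp_form : hyperbolic_form iota form eps hform.

Let W := hyperbolic_weyl_group iota hform R.
Local Notation dual := (dual_space V0).

Definition eps_form (v : V) : K := hform (iota eps, 0) (v, 0).
Definition dual_eval (l : dual) (s : A) : K := l (vsproj V0 (iota s)).

Lemma eps_formP a u v : eps_form (a *: u + v) = a * eps_form u + eps_form v.
Proof.
rewrite /eps_form -(hform_linear hyp_form); congr hform.
by apply: injective_projections; rewrite /= ?scaler0 ?addr0.
Qed.

Lemma eps_formD u v : eps_form (u + v) = eps_form u + eps_form v.
Proof. by rewrite -{1}[u]scale1r eps_formP mul1r. Qed.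

Lemma eps_form0 : eps_form 0 = 0.
Proof. by apply: (addrI (eps_form 0)); rewrite -eps_formD !addr0. Qed.

Lemma eps_formZ a u : eps_form (a *: u) = a * eps_form u.
Proof. by rewrite -[_ *: _]addr0 eps_formP eps_form0 addr0. Qed.

Lemma eps_formN u : eps_form (- u) = - eps_form u.
Proof. by rewrite -scaleN1r eps_formZ mulN1r. Qed.

Lemma eps_formB u v : eps_form (u - v) = eps_form u - eps_form v.
Proof. by rewrite eps_formD eps_formN. Qed.

Lemma eps_form_eps : eps_form (iota eps) = 2.
Proof. by rewrite /eps_form (hform_form hyp_form) (A1_eps_norm R_desc) ratr_nat. Qed.

Lemma eps_form_rad s : radical form s -> eps_form (iota s) = 0.
Proof.
by move=> rs; rewrite /eps_form (hform_form hyp_form) (psd_sym form_psd) rs rmorph0.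
Qed.

(** On the image of [iota] the functional vanishes; the uniqueness clause of the scalar extension
    then makes it zero on all of [V]. *)
Lemma hform_rad s v : radical form s -> hform (iota s, 0) (v, 0) = 0.
Proof.
move=> rs; pose f (u : V) : K^o := hform (iota s, 0) (u, 0).
have f_lin : linear f.
  move=> a u w; rewrite /f -[RHS](hform_linear hyp_form); congr hform.
  by apply: injective_projections; rewrite /= ?scaler0 ?addr0.
pose fL : {linear V -> K^o} := HB.pack f (GRing.isLinear.Build K V K^o *:%R f f_lin).
have [g _ g_uniq] := iota_ext (\0 : {additive A -> K^o}).
rewrite -[LHS]/(fL v) (g_uniq fL) => [|a]; last first.
  by rewrite /fL /f /= (hform_form hyp_form) rs rmorph0.
by rewrite -(g_uniq (\0 : {linear V -> K^o})).
Qed.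

Lemma iota_V0 s : radical form s -> iota s \in V0.
Proof. by move=> rs; apply: V0_span.1; exists s. Qed.

(** For radical [s], the reflection in [eps + s] in components: this root has norm 2, so the coroot
    pairing is the pairing with the root itself. *)
Definition refl_map (s : A) (b : hyp_space V0) : hyp_space V0 :=
  (b.1 - (eps_form b.1 + dual_eval b.2 s) *: (iota eps + iota s), b.2).

Lemma hform_root s (b : hyp_space V0) : radical form s ->
  hform b (iota (eps + s), 0) = eps_form b.1 + dual_eval b.2 s.
Proof.
move=> rs; have hformDr u v w : hform u (v + w) = hform u v + hform u w.
  by rewrite -{1}[v]scale1r (hform_linear hyp_form) mul1r.
have hformDl u v w : hform (u + v) w = hform u w + hform v w.
  by rewrite (hform_sym hyp_form) hformDr !(hform_sym hyp_form w).
case: b => v l; have -> : ((v, l) : hyp_space V0) = (v, 0) + (0, l).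
  by apply: injective_projections; rewrite /= ?addr0 ?add0r.
have -> : ((iota (eps + s), 0) : hyp_space V0) = (iota eps, 0) + (iota s, 0).
  by rewrite raddfD; apply: injective_projections; rewrite /= ?addr0.
rewrite hformDl !hformDr !(hform_sym hyp_form (_, _) (iota _, 0)).
rewrite (hform_rad _ rs) (hform_eps hyp_form) addr0 add0r /= addr0 add0r.
congr (_ + _); rewrite -{1}[iota s](vsprojK (iota_V0 rs)).
exact: (hform_eval hyp_form).
Qed.

Lemma reflection_root s : radical form s ->
  reflection hform (iota (eps + s), 0) =1 refl_map s.
Proof.
move=> rs [v l]; rewrite /reflection /pairing_coroot.
have norm2 : hform (iota (eps + s), 0) (iota (eps + s), 0) = 2.
  rewrite (hform_root _ rs) /= raddfD eps_formD eps_form_eps (eps_form_rad rs) addr0.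
  by rewrite /dual_eval zero_lfunE addr0.
rewrite norm2 pnatr_eq0 /= (hform_root _ rs) mulrAC divff ?pnatr_eq0 // mul1r.
by apply: injective_projections; rewrite /= ?raddfD // scaler0 oppr0 addr0.
Qed.

Lemma reflectionN a : reflection hform (iota (- a), 0) =1 reflection hform (iota a, 0).
Proof.
move=> b; have hformNr u (v : hyp_space V0) : hform u (- v) = - hform u v.
  have hform0 : hform u 0 = 0.
    have := hform_linear hyp_form u 1 0 0; rewrite scale1r addr0 mul1r => h0.
    by apply: (addrI (hform u 0)); rewrite -h0 addr0.
  by rewrite -[- v]addr0 -scaleN1r (hform_linear hyp_form) hform0 mulN1r addr0.
have -> : ((iota (- a), 0) : hyp_space V0) = - (iota a, 0).
  by rewrite raddfN; apply: injective_projections; rewrite /= ?oppr0.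
rewrite /reflection /pairing_coroot !hformNr (hform_sym hyp_form (- _)) hformNr opprK.
by case: ifP => _; rewrite ?scale0r // mulrN mulNr scaleNr scalerN opprK.
Qed.

Lemma reflection_rad a : radical form a -> reflection hform (iota a, 0) =1 id.
Proof.
move=> ra b; rewrite /reflection /pairing_coroot (hform_form hyp_form) ra rmorph0 eqxx.
by rewrite scale0r subr0.
Qed.

Lemma reflection_R a : R a -> reflection hform (iota a, 0) =1 id \/
  exists2 s, S s & reflection hform (iota a, 0) =1 refl_map s.
Proof.
have S_rad := A1_S_sub R_desc.
rewrite (A1_roots R_desc) => -[[s Ss [t St <-]]|[c c_eps [s Ss <-]]].
  by left; apply: reflection_rad; apply: (radicalD form_psd); apply: S_rad.
case: c_eps => [[->|->]|->].
- by left; rewrite add0r; apply: reflection_rad; apply: S_rad.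
- by right; exists s => //; apply: reflection_root; apply: S_rad.
(* [- eps + s] is the negative of [eps - s] and defines the same reflection; [- s] lies in [S]
   because it is [s - s *+ 2]. *)
right; exists (- s).
  by have [_] := A1_S_stable R_desc Ss Ss; rewrite mulr2n opprD addNKr.
move=> b; rewrite -[- eps + s]opprK opprD opprK reflectionN.
by apply: reflection_root; apply: (radicalN form_psd); apply: S_rad.
Qed.

Lemma R_root s : S s -> R (eps + s).
Proof.
by move=> Ss; rewrite (A1_roots R_desc); right; exists eps; [left; right | exists s].
Qed.

Lemma eps_form_root s : radical form s -> eps_form (iota eps + iota s) = 2.
Proof. by move=> rs; rewrite eps_formD eps_form_eps eps_form_rad // addr0. Qed.

Lemma refl_mapK s : radical form s -> involutive (refl_map s).
Proof.
move=> rs [v l]; rewrite /refl_map /=; congr pair.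
rewrite eps_formB eps_formZ eps_form_root // -[LHS]addrA -opprD -scalerDl.
by set k := (X in X *: _); have -> : k = 0; [rewrite /k; ring | rewrite scale0r subr0].
Qed.

Lemma refl_aut s : radical form s ->
  exists g : linear_aut (hyp_space V0), forall b, val g b = refl_map s b.
Proof.
move=> rs; have refl_lin : linear (refl_map s).
  move=> a [v l] [v' l']; rewrite /refl_map /=; apply: injective_projections => //=.
  rewrite eps_formP /dual_eval add_lfunE scale_lfunE /= scalerBr scalerA [RHS]addrACA -opprD.
  rewrite -scalerDl; congr (_ - _ *: _).
  by rewrite mulrDr addrACA.
pose f : {linear hyp_space V0 -> hyp_space V0} :=
  HB.pack (refl_map s) (GRing.isLinear.Build K _ _ *:%R (refl_map s) refl_lin).
have f_inj : lker (linfun f) == 0%VS.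
  by apply/lker0P => b c; rewrite !lfunE; apply: (can_inj (refl_mapK rs)).
by exists (exist (@aut_pred _ _) (linfun f) f_inj) => b; rewrite [LHS]lfunE.
Qed.

Definition act (g : W) (b : hyp_space V0) : hyp_space V0 := val (val g) b.

Lemma actM g h b : act (g * h)%g b = act g (act h b).
Proof. exact: comp_lfunE. Qed.

Lemma act1 b : act 1%g b = b.
Proof. exact: id_lfunE. Qed.

Lemma act_inj g h : act g =1 act h -> g = h.
Proof. by move=> gh; apply/val_inj/val_inj/lfunP. Qed.

Lemma actK g : cancel (act g) (act g^-1%g).
Proof. by move=> b; rewrite -actM mulVg act1. Qed.

Lemma refl_W s : S s -> exists g : W, forall b, act g b = refl_map s b.
Proof.
move=> Ss; have rs := A1_S_sub R_desc Ss; have [g g_act] := refl_aut rs.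
suff Wg : gen_pred [set g : linear_aut (hyp_space V0) | exists2 a, R a &
    forall b, val g b = reflection hform (iota a, 0) b]%classic g.
  by exists (exist _ g Wg).
apply/asboolP => H [_]; apply; exists (eps + s); first exact: R_root.
by move=> b; rewrite g_act reflection_root.
Qed.

Local Notation std_tau := (std_tau form nu eps tau).

Lemma dual_evalE l s u w (a b : K) :
  radical form s -> radical form u -> radical form w ->
  iota s = a *: iota u + b *: iota w ->
  dual_eval l s = a * dual_eval l u + b * dual_eval l w.
Proof. by move=> rs ru rw eq_s; rewrite /dual_eval eq_s !linearP !linearZ. Qed.

(** Coordinates along [eps], [u] and [w]: a product of reflections in roots over these two radical
    directions is computed on three coefficients, where [ring] settles the identities. *)
Lemma refl_map_comb (u w s : A) (x y : K) v l a b c :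
    radical form u -> radical form w -> radical form s ->
    iota s = x *: iota u + y *: iota w ->
  let k := eps_form v + 2 * a + x * dual_eval l u + y * dual_eval l w in
  refl_map s (v + (a *: iota eps + (b *: iota u + c *: iota w)), l) =
    (v + ((a - k) *: iota eps + ((b - k * x) *: iota u + (c - k * y) *: iota w)), l).
Proof.
move=> ru rw rs eq_s k; rewrite /refl_map /=; congr pair.
rewrite !eps_formD !eps_formZ eps_form_eps !eps_form_rad // !mulr0 !addr0.
rewrite (dual_evalE l rs ru rw eq_s) eq_s -[LHS]addrA; congr (_ + _).
have -> : eps_form v + a * 2 + (x * dual_eval l u + y * dual_eval l w) = k.
  by rewrite /k; ring.
clearbody k; rewrite !scalerDr !scalerA !opprD [LHS]addrACA -scalerBl; congr (_ + _).
by rewrite [LHS]addrACA -!scalerBl.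
Qed.

(* By conjugation, the set of [s] whose reflection lies in the image is stable
   under [(s, t) |-> 2 s - t], hence under translation by [2 Lambda]. *)
Lemma refl_generate (G : groupType) (F : UMagmaMorphism.type G W) (rho : 'I_m.+1 -> G) :
    (forall k, act (F (rho k)) =1 refl_map (std_tau k)) ->
  forall g : W, exists h, F h = g.
Proof.
move=> F_rho; pose P s := exists h, act (F h) =1 refl_map s.
have S_rad := A1_S_sub R_desc.
have std_rad k : radical form (std_tau k).
  exact/S_rad/(std_tau_S form_psd R_desc S_desc).
have P_refl s t : radical form s -> radical form t -> P s -> P t -> P (s *+ 2 - t).
  move=> rs rt [h hs] [k kt]; exists (h * k * h)%g => -[v l].
  rewrite !gmulfM !actM hs kt hs.
  have r2 : radical form (s *+ 2 - t) by apply/(radicalB form_psd)/rt/radicalMn.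
  rewrite -[v in LHS]addr0 -[v in RHS]addr0.
  have zero_comb : 0 = 0 *: iota eps + (0 *: iota s + 0 *: iota t).
    by rewrite !scale0r !addr0.
  rewrite zero_comb.
  rewrite (refl_map_comb v l _ _ _ rs rt rs (x := 1) (y := 0));
    last by rewrite scale1r scale0r addr0.
  rewrite (refl_map_comb v l _ _ _ rs rt rt (x := 0) (y := 1));
    last by rewrite scale1r scale0r add0r.
  rewrite (refl_map_comb v l _ _ _ rs rt rs (x := 1) (y := 0));
    last by rewrite scale1r scale0r addr0.
  rewrite (refl_map_comb v l _ _ _ rs rt r2 (x := 2) (y := -1)); last first.
    by rewrite raddfB raddfMn scaleN1r scaler_nat.
  by congr (v + (_ *: _ + (_ *: _ + _ *: _)), l); ring.
pose Q s := radical form s /\ P s.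
have Q_refl s t : Q s -> Q t -> Q (s *+ 2 - t).
  move=> [rs Ps] [rt Pt]; split; last exact: P_refl.
  exact/(radicalB form_psd)/rt/radicalMn.
have Q_std k : Q (std_tau k) by split=> //; exists (rho k).
have Q0 : Q 0 by rewrite -(std_tau0 form_psd R_desc S_desc).
have QN t : Q t -> Q (- t) by move=> Qt; have := Q_refl _ _ Q0 Qt; rewrite mul0rn add0r.
(* The map [t |-> - t] followed by [t |-> 2 tau i - t] is the translation by [2 tau i]; the opposite
   order handles negative multiples. *)
have Q_shift t i n : @sigma_index nu m i -> Q t -> Q (t + tau i *~ n *+ 2).
  move=> iP Qt; have Qi : Q (tau i) by rewrite -(std_tau_sigma form_psd R_desc S_desc iP).
  elim: n => [|n IHn|n IHn]; first by rewrite mulr0z mul0rn addr0.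
    have := Q_refl _ _ Qi (QN _ IHn); rewrite opprK intS mulrzDr mulr1z mulrnDl.
    by rewrite addrCA addrA.
  have -> : tau i *~ - n.+1%:Z = tau i *~ (- n%:Z) - tau i.
    by rewrite intS opprD mulrzDr addrC mulrN1z.
  have := QN _ (Q_refl _ _ Qi IHn).
  by rewrite opprB mulrnBl -addrA.
have Q_lattice t l : radical form l -> Q t -> Q (t + l *+ 2).
  have [_ tau_span _] := coset_basis S_desc => /tau_span[c ->] Qt.
  elim/big_rec: _ => [|i l' iP Ql']; first by rewrite mul0rn addr0.
  by rewrite mulrnDl addrCA addrC; apply: Q_shift.
have P_S s : S s -> P s.
  rewrite (coset_cover S_desc) => -[k [l rl ->]].
  have [l' rl' ->] := std_tau_coset form_psd R_desc S_desc k.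
  by apply: (Q_lattice _ _ rl (Q_lattice _ _ rl' (Q_std k))).2.
move=> [g Wg]; move/asboolP: (Wg) => gen_g.
(* The image of [F] is a subgroup containing every reflection in a root, hence the whole generated
   group. *)
have [] : [set x | exists h, val (F h) = x]%classic g; last first.
  by move=> h Fh; exists h; apply: val_inj.
apply: gen_g; split; first split.
- by exists 1%g; apply: (congr1 val (@gmulf1 _ _ F)).
- by move=> _ _ [h <-] [k <-]; exists (h * k)%g; apply: (congr1 val (@gmulfM _ _ F h k)).
- by move=> _ [h <-]; exists h^-1%g; apply: (congr1 val (@gmulfV _ _ F h)).
move=> x [a /reflection_R[refl_id|[s Ss refl_s]] x_refl].
  exists 1%g; rewrite (@gmulf1 _ _ F); apply/val_inj/lfunP => b.
  by rewrite x_refl refl_id; apply: act1.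
have [h hs] := P_S s Ss; exists h; apply/val_inj/lfunP => b.
by rewrite x_refl refl_s -hs.
Qed.

(** The universal property extends the integral coordinate along [tau p] to the functional [h] on
    [V]; restricting [h] to [V0] gives the dual basis vector [l]. *)
Lemma dual_coords p : @sigma_index nu m p ->
  exists (h : {linear V -> K^o}) (l : dual),
    (forall j, @sigma_index nu m j -> h (iota (tau j)) = (j == p)%:R) /\
    (forall j, @sigma_index nu m j -> dual_eval l (tau j) = (j == p)%:R).
Proof.
move=> pP; have [f [fB f_tau]] := lattice_coord form_psd R_desc S_desc pP.
pose fK (a : A) : K^o := (f a)%:~R.
have fK_additive : zmod_morphism fK by move=> a b; rewrite /fK fB rmorphB.
pose fA : {additive A -> K^o} :=
  HB.pack fK (GRing.isZmodMorphism.Build A K^o fK fK_additive).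
have [h h_iota _] := iota_ext fA.
have h_tau j : @sigma_index nu m j -> h (iota (tau j)) = (j == p)%:R.
  by move=> jP; rewrite h_iota /= /fK f_tau // -pmulrn.
exists h, (linfun (h \o vsval)); split=> // j jP.
rewrite /dual_eval lfunE /= vsprojK ?h_tau //.
exact/iota_V0/(tau_radical form_psd R_desc S_desc).
Qed.

(** * Relations satisfied by the chosen reflections *)

Variable rho : 'I_m.+1 -> W.
Hypothesis rho_act : forall k, act (rho k) =1 refl_map (std_tau k).

Let tau_rad i : radical form (tau i) := tau_radical form_psd R_desc S_desc i.
Let std_rad k : radical form (std_tau k) :=
  A1_S_sub R_desc (std_tau_S form_psd R_desc S_desc k).

Lemma rho_invol k : (rho k * rho k)%g = 1%g.
Proof.
by apply: act_inj => b; rewrite actM !rho_act act1 refl_mapK.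
Qed.

(* The map [c(tau i, tau j)^k]. *)
Definition transvection (k : K) i j (b : hyp_space V0) : hyp_space V0 :=
  (b.1 + ((- (k * dual_eval b.2 (tau j))) *: iota (tau i) +
          (k * dual_eval b.2 (tau i)) *: iota (tau j)), b.2).

Lemma transvection_comb k i j v l a b c :
  transvection k i j (v + (a *: iota eps + (b *: iota (tau i) + c *: iota (tau j))), l) =
  (v + (a *: iota eps + ((b - k * dual_eval l (tau j)) *: iota (tau i) +
     (c + k * dual_eval l (tau i)) *: iota (tau j))), l).
Proof.
rewrite /transvection /= -!addrA; congr (_ + (_ + _), _).
by rewrite addrA [LHS]addrACA -!scalerDl.
Qed.

Lemma act_triple i j v l a b c : @sigma_index nu m i -> @sigma_index nu m j ->
  let k := eps_form v + 2 * a in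
  let x := dual_eval l (tau i) in let y := dual_eval l (tau j) in
  act (rho i * (rho ord0 * rho j))%g
    (v + (a *: iota eps + (b *: iota (tau i) + c *: iota (tau j))), l) =
  (v + ((a - (k + x + y)) *: iota eps + ((b - (k + x + 2 * y)) *: iota (tau i) +
     (c - (k + y)) *: iota (tau j))), l).
Proof.
move=> iP jP k x y; rewrite !actM !rho_act.
rewrite (refl_map_comb v l _ _ _ (tau_rad i) (tau_rad j) (std_rad j)
  (x := 0) (y := 1)); last first.
  by rewrite (std_tau_sigma form_psd R_desc S_desc jP) scale0r scale1r add0r.
rewrite (refl_map_comb v l _ _ _ (tau_rad i) (tau_rad j) (std_rad ord0)
  (x := 0) (y := 0)); last first.
  by rewrite (std_tau0 form_psd R_desc S_desc) raddf0 !scale0r addr0.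
rewrite (refl_map_comb v l _ _ _ (tau_rad i) (tau_rad j) (std_rad i)
  (x := 1) (y := 0)); last first.
  by rewrite (std_tau_sigma form_psd R_desc S_desc iP) scale0r scale1r addr0.
by rewrite /k /x /y; congr (v + (_ *: _ + (_ *: _ + _ *: _)), l); ring.
Qed.

Lemma ordered_pair_sigma (p : 'I_m.+1 * 'I_m.+1) : ordered_pair nu p ->
  @sigma_index nu m p.1 /\ @sigma_index nu m p.2.
Proof.
move=> /and3P[i_gt ij j_le]; split; apply/andP; split=> //.
  exact/ltnW/(leq_trans ij).
exact: leq_ltn_trans ij.
Qed.

Lemma zero_comb i j (v : V) :
  v = v + (0 *: iota eps + (0 *: iota (tau i) + 0 *: iota (tau j))).
Proof. by rewrite !scale0r !addr0. Qed.

(** In the notation of [act_triple], the triple changes the [eps] coefficient by [-(k + x + y)].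
    Reflecting in [eps + tau i + tau j] restores it and leaves only the skew terms [- y] and [x]. *)
Lemma act_supp (p : 'I_m.+1 * 'I_m.+1) s : ordered_pair nu p ->
    supp form nu eps tau (refl_base_root eps tau s) = [set p.1; p.2]%SET ->
  act (rho s * (rho p.1 * (rho ord0 * rho p.2)))%g =1 transvection 1 p.1 p.2.
Proof.
case: p => i j /= pij supp_s [v l]; have [/= iP jP] := ordered_pair_sigma pij.
rewrite (zero_comb i j v) actM act_triple // rho_act transvection_comb.
rewrite (refl_map_comb v l _ _ _ (tau_rad i) (tau_rad j) (std_rad s)
  (x := 1) (y := 1)); last first.
  case/and3P: pij => /= _ ij _.
  by rewrite (std_tau_pair ij supp_s) raddfD !scale1r.
by congr (v + (_ *: _ + (_ *: _ + _ *: _)), l); ring.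
Qed.

Lemma act_triple_sq (p : 'I_m.+1 * 'I_m.+1) : ordered_pair nu p ->
  act ((rho p.1 * (rho ord0 * rho p.2)) ^+ 2)%g =1 transvection 2 p.1 p.2.
Proof.
case: p => i j /= pij [v l]; have [/= iP jP] := ordered_pair_sigma pij.
rewrite (zero_comb i j v) expg2 actM !act_triple // transvection_comb.
by congr (v + (_ *: _ + (_ *: _ + _ *: _)), l); ring.
Qed.

(** A transvection adds a radical vector depending only on the dual component, while the vector
    subtracted by a reflection depends on the [V] component only through [eps_form], which kills
    radical vectors. *)
Lemma transvection_commute (g : W) x i j k :
  act g =1 transvection x i j -> commute (rho k) g.
Proof.
move=> g_act; apply: act_inj => -[v l].
rewrite !actM !g_act !rho_act /refl_map /transvection /=.
by rewrite !eps_formD !eps_formZ !(eps_form_rad (tau_rad _)) !mulr0 !addr0 addrAC.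
Qed.

(* [shifts g a]: up to a map depending only on the component in [(V^0)*], [g]
   acts on [V] and on [(V^0)*] as the translation by [a]. *)
Definition shifts (g : W) (a : A) : Prop :=
  radical form a /\ exists2 beta : dual -> V, (forall l, eps_form (beta l) = 0) &
    forall v l, act g (v, l) =
      (v + eps_form v *: iota a - dual_eval l a *: iota eps + beta l, l).

Lemma dual_evalD l s t : dual_eval l (s + t) = dual_eval l s + dual_eval l t.
Proof. by rewrite /dual_eval !raddfD. Qed.

Lemma dual_evalN l s : dual_eval l (- s) = - dual_eval l s.
Proof. by rewrite /dual_eval !raddfN. Qed.

Lemma dual_eval0 l : dual_eval l 0 = 0.
Proof. by rewrite /dual_eval !raddf0. Qed.

Lemma shifts1 : shifts 1%g 0.
Proof.
split; first exact: radical0; exists (fun=> 0) => [l|v l]; first exact: eps_form0.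
by rewrite act1 raddf0 dual_eval0 scaler0 scale0r subr0 !addr0.
Qed.

Lemma shiftsM g h a b : shifts g a -> shifts h b -> shifts (g * h)%g (a + b).
Proof.
move=> [ra [bg bg0 g_act]] [rb [bh bh0 h_act]]; split; first exact: radicalD.
(* The middle term arises when [g] acts on the vector [- dual_eval l b *: iota eps] contributed by
   [h], whose [eps_form] is [- 2 * dual_eval l b]. *)
exists (fun l => bh l - (2 * dual_eval l b) *: iota a + bg l) => [l|v l].
  by rewrite eps_formD eps_formB eps_formZ bg0 bh0 (eps_form_rad ra) mulr0 subr0 addr0.
rewrite actM h_act g_act; congr pair.
rewrite !(eps_formD, eps_formN, eps_formZ) bh0 (eps_form_rad rb) eps_form_eps dual_evalD.
(* Passing to row vectors turns the vector identity into scalar ones for [ring]. *)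
rewrite raddfD; apply: (can_inj v2rK); apply/rowP => i.
by rewrite !(linearD, linearN, linearZ, mxE) /=; ring.
Qed.

Lemma shiftsV g a : shifts g a -> shifts g^-1%g (- a).
Proof.
move=> [ra [bg bg0 g_act]]; split; first exact: radicalN.
exists (fun l => - bg l - (2 * dual_eval l a) *: iota a) => [l|v l].
  by rewrite eps_formB eps_formN eps_formZ (eps_form_rad ra) bg0 mulr0 oppr0 addr0.
(* It suffices to check that [g] sends the candidate [c] back to [v]. *)
set c := (X in _ = (X, l)); rewrite -(actK g (c, l)) g_act; congr (act _ (_, _)).
rewrite {1}/c; have -> : eps_form c = eps_form v + 2 * dual_eval l a.
  rewrite /c dual_evalN raddfN !(eps_formD, eps_formN, eps_formZ, eps_form_eps).
  by rewrite bg0 (eps_form_rad ra); ring.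
rewrite dual_evalN raddfN; apply: (can_inj v2rK); apply/rowP => i.
by rewrite !(linearD, linearN, linearZ, mxE) /=; ring.
Qed.

Lemma shifts_transl i : @sigma_index nu m i -> shifts (rho i * rho ord0)%g (tau i).
Proof.
move=> iP; split; first exact: tau_rad.
exists (fun l => (- dual_eval l (tau i)) *: iota (tau i)) => [l|v l].
  by rewrite eps_formZ eps_form_rad ?mulr0.
rewrite actM !rho_act /refl_map /= (std_tau0 form_psd R_desc S_desc).
rewrite (std_tau_sigma form_psd R_desc S_desc iP) raddf0 dual_eval0 !addr0.
rewrite eps_formB eps_formZ eps_form_eps; congr pair.
apply: (can_inj v2rK); apply/rowP => j.
by rewrite !(linearD, linearN, linearZ, mxE) /=; ring.
Qed.

Lemma shifts_transvection g k i j : act g =1 transvection k i j -> shifts g 0.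
Proof.
move=> g_act; split; first exact: radical0.
eexists => [l|v l]; last first.
  by rewrite g_act /transvection /= raddf0 dual_eval0 scaler0 scale0r subr0 addr0.
by rewrite eps_formD !eps_formZ !eps_form_rad ?mulr0 ?addr0.
Qed.

(** Over the zero dual component, evaluation at 0 gives [beta 0 = 0]; evaluation at [iota eps],
    whose [eps_form] is 2, then exposes [iota a *+ 2]. *)
Lemma shifts_id a : shifts 1%g a -> iota a *+ 2 = 0.
Proof.
move=> [ra [b b0 act_1]]; have := act_1 0 0.
rewrite act1 eps_form0 /dual_eval zero_lfunE !scale0r subr0 !add0r => -[b_0].
have := act_1 (iota eps) 0; rewrite act1 -b_0 /dual_eval zero_lfunE scale0r subr0 addr0.
by rewrite eps_form_eps scaler_nat -{1}[iota eps]addr0 => -[/addrI].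
Qed.

(** Over the zero dual component [g] preserves [eps_form] of [iota eps], whereas [rho ord0] negates
    it: the product being 1 would give [-2 = 2]. *)
Lemma shifts_sign g a : shifts g a -> (rho ord0 * g)%g <> 1%g.
Proof.
move=> [ra [b b0 g_act]] /(congr1 (fun h => act h (iota eps, 0))).
rewrite act1 actM g_act rho_act /refl_map (std_tau0 form_psd R_desc S_desc) => -[].
move/(congr1 eps_form); rewrite /= dual_eval0 raddf0 !addr0.
rewrite /dual_eval zero_lfunE scale0r subr0.
rewrite !(eps_formD, eps_formN, eps_formZ, eps_form_eps, b0) (eps_form_rad ra).
rewrite !mulr0 !addr0 => /eqP; rewrite -subr_eq0 (_ : _ - _ = - 4%:R); last by ring.
by rewrite oppr_eq0 pnatr_eq0.
Qed.

(* For [h] and [l] taken from dual bases this isolates one coefficient of a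
   product of transvections. *)
Definition fiber_shift (h : V -> K) (l : dual) (g : W) (k : K) : Prop :=
  exists2 b, h b = k & forall v, act g (v, l) = (v + b, l).

Section FiberShift.
Variables (h : {linear V -> K^o}) (l : dual).

Lemma fiber_shift1 : fiber_shift h l 1%g 0.
Proof. by exists 0; rewrite ?raddf0 // => v; rewrite act1 addr0. Qed.

Lemma fiber_shiftM g g' k k' : fiber_shift h l g k -> fiber_shift h l g' k' ->
  fiber_shift h l (g * g')%g (k + k').
Proof.
move=> [b <- g_act] [b' <- g'_act]; exists (b + b'); first by rewrite raddfD.
by move=> v; rewrite actM g'_act g_act -addrA (addrC b').
Qed.

Lemma fiber_shiftV g k : fiber_shift h l g k -> fiber_shift h l g^-1%g (- k).
Proof.
move=> [b <- g_act]; exists (- b); first by rewrite raddfN.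
by move=> v; rewrite -[in LHS](subrK b v) -g_act actK.
Qed.

End FiberShift.

(** * The isomorphism *)

Local Notation rels := (hyp_relator form nu eps tau).
Local Notation root_supp k := (supp form nu eps tau (refl_base_root eps tau k)).
Let G : groupType := hyp_presentation form nu eps tau.
Let x (k : 'I_m.+1) : G := pres_gen rels k.

Lemma rho_relator r : rels r -> word_eval rho r = 1%g.
Proof.
case=> [k|k i j s i_gt ij s_gt supp_s|k i j i_gt ij nsupp].
- by rewrite word_eval_cat !word_eval_gen rho_invol.
- apply/word_eval_wcomm; rewrite !word_eval_cat !word_eval_gen.
  apply: transvection_commute; apply: (act_supp (p := (i, j))); last by rewrite supp_s.
  exact/andP.
apply/word_eval_wcomm; rewrite !word_eval_cat !word_eval_gen -expg2.
by apply: transvection_commute; apply: (act_triple_sq (p := (i, j))); apply/andP.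
Qed.

Lemma pres_gen_invol k : (x k * x k = 1)%g.
Proof.
by have := pres_gen_rel (RelInvol form nu eps tau k); rewrite word_eval_cat !word_eval_gen.
Qed.

Lemma pres_gen_commute_supp k (s : 'I_m.+1) (p : 'I_m.+1 * 'I_m.+1) :
    ordered_pair nu p -> (nu < s)%N -> root_supp s = [set p.1; p.2]%SET ->
  commute (x k) (x s * (x p.1 * (x ord0 * x p.2)))%g.
Proof.
case/andP=> p1_gt p12 s_gt supp_s.
have := pres_gen_rel (RelSupp k p1_gt p12 s_gt (esym supp_s)).
by rewrite word_eval_wcomm !word_eval_cat !word_eval_gen.
Qed.

(** Only indices beyond [nu] have to be ruled out: the supports of the other base roots have at most
    one element. *)
Lemma pres_gen_commute_triple k (p : 'I_m.+1 * 'I_m.+1) : ordered_pair nu p ->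
    (forall s : 'I_m.+1, (nu < s)%N -> root_supp s <> [set p.1; p.2]%SET) ->
  commute (x k) ((x p.1 * (x ord0 * x p.2)) ^+ 2)%g.
Proof.
case/andP=> p1_gt p12 nsupp.
have {}nsupp : ~ [set supp form nu eps tau a | a in refl_base eps tau]%classic
    [set p.1; p.2]%SET.
  move=> [_ [s _ <-] supp_s]; have [/nsupp|s_le] := ltnP nu s; first exact.
  have := congr1 (fun B : {set 'I_m.+1} => #|B|) supp_s.
  rewrite cards2 (_ : p.1 != p.2); last first.
    by case/andP: p12 => p12 _; apply: contraTneq p12 => ->; rewrite ltnn.
  have [s0|s_gt] := posnP s.
    have -> : s = ord0 by apply: val_inj.
    by rewrite (root_supp0 form_psd R_desc S_desc) cards0.
  rewrite (root_supp_sigma form_psd R_desc S_desc) ?cards1 //.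
  exact/andP.
have := pres_gen_rel (RelNonSupp k p1_gt p12 nsupp).
by rewrite word_eval_wcomm !word_eval_cat !word_eval_gen -expg2.
Qed.

(** * Central elements of the presented group *)

Lemma pres_central g : (forall k, commute (x k) g) -> forall h, commute g h.
Proof.
move=> xg; apply: pres_group_ind => [|k h gh|k h gh]; first exact: commute1.
  by apply: commuteM => //; apply/commute_sym/xg.
by apply: commuteM => //; apply/commuteV/commute_sym/xg.
Qed.

(** When the pair is a support this is a square root of [(x_i x_0 x_j)^2], and otherwise that square
    itself. The default 1 permits products over all pairs. *)
Definition central_gen (p : 'I_m.+1 * 'I_m.+1) : G :=
  if ordered_pair nu p then
    if [pick s : 'I_m.+1 | (nu < s)%N && (root_supp s == [set p.1; p.2]%SET)] is Some s
    then (x s * (x p.1 * (x ord0 * x p.2)))%g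
    else ((x p.1 * (x ord0 * x p.2)) ^+ 2)%g
  else 1%g.

Lemma central_genP p : ordered_pair nu p ->
  (exists s : 'I_m.+1, [/\ (nu < s)%N, root_supp s = [set p.1; p.2]%SET &
     central_gen p = (x s * (x p.1 * (x ord0 * x p.2)))%g]) \/
  ((forall s : 'I_m.+1, (nu < s)%N -> root_supp s <> [set p.1; p.2]%SET) /\
   central_gen p = ((x p.1 * (x ord0 * x p.2)) ^+ 2)%g).
Proof.
rewrite /central_gen => ->; case: pickP => [s /andP[s_gt /eqP supp_s]|nsupp].
  by left; exists s.
by right; split=> // s s_gt supp_s; have := nsupp s; rewrite s_gt supp_s eqxx.
Qed.

Lemma central_gen_central p g : commute (central_gen p) g.
Proof.
apply: pres_central => k; have [pP|pP] := boolP (ordered_pair nu p); last first.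
  by rewrite /central_gen (negPf pP); apply: commute1.
have [[s [s_gt supp_s ->]]|[nsupp ->]] := central_genP pP.
  exact: pres_gen_commute_supp.
exact: pres_gen_commute_triple.
Qed.

(** The exponent is 2 for a support and 1 otherwise. For a support, with [t] the triple and
    [x s = z * t^-1], centrality of [z] turns [x s ^+ 2 = 1] into [z ^+ 2 = t ^+ 2]. *)
Lemma triple_sq_central p : ordered_pair nu p ->
  exists n : nat, ((x p.1 * x ord0 * x p.2) ^+ 2 = central_gen p ^+ n)%g.
Proof.
move=> pP; rewrite -mulgA; have [[s [s_gt supp_s eq_z]]|[nsupp eq_z]] := central_genP pP.
  exists 2%N; set t := (x p.1 * _)%g; have x_s : x s = (central_gen p * t^-1)%g.
    by rewrite eq_z mulgK.
  have := pres_gen_invol s; rewrite x_s.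
  rewrite -expg2 (expgMn 2 (central_gen_central p t^-1%g)) expVgn => /mulg1_eq.
  by move/invg_inj.
by exists 1%N; rewrite eq_z expg1.
Qed.

(** Supports are injective, so the index picked in [central_gen] is [s] itself, and the definition
    can be solved for [x s]. *)
Lemma pres_gen_gt_nu (s : 'I_m.+1) : (nu < s)%N ->
  exists2 p, ordered_pair nu p & (x s = central_gen p * (x p.2 * x ord0 * x p.1))%g.
Proof.
move=> s_gt; have [p pP supp_s] := root_supp_gt form_psd R_desc S_desc elliptic s_gt.
exists p => //; have [[s' [_ supp_s' ->]]|[/(_ s s_gt) //]] := central_genP pP.
have -> : s' = s.
  by apply: (root_supp_inj form_psd R_desc S_desc); rewrite /= supp_s supp_s'.
have xK k g : (x k * (x k * g) = g)%g by rewrite mulgA pres_gen_invol mul1g.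
by rewrite -!mulgA !xK pres_gen_invol mulg1.
Qed.

(** * Injectivity of the homomorphism *)

Section Isomorphism.
Variable F : UMagmaMorphism.type G W.
Hypothesis F_gen : forall k, F (x k) = rho k.

(** [kappa] is 1 on supports, 2 on the remaining ordered pairs and 0 elsewhere; injectivity depends
    only on where it vanishes. *)
Lemma act_central_gen p : exists kappa : K,
  [/\ ordered_pair nu p -> kappa != 0, ~~ ordered_pair nu p -> kappa = 0 &
      act (F (central_gen p)) =1 transvection kappa p.1 p.2].
Proof.
have [pP|pP] := boolP (ordered_pair nu p); last first.
  exists 0; split=> // -[v l]; rewrite /central_gen (negPf pP) (@gmulf1 _ _ F) act1.
  by rewrite /transvection /= !mul0r oppr0 !scale0r !addr0.
have [[s [s_gt supp_s ->]]|[_ ->]] := central_genP pP.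
  exists 1; split=> // [|b]; first by rewrite oner_neq0.
  by rewrite !(@gmulfM _ _ F) !F_gen; apply: act_supp.
exists 2; split=> // [|b]; first by rewrite pnatr_eq0.
by rewrite (@gmulfXn _ _ F) !(@gmulfM _ _ F) !F_gen; apply: act_triple_sq.
Qed.

Lemma kernel_trivial g : F g = 1%g -> g = 1%g.
Proof.
have gen_g (P : G -> Prop) : P 1%g -> (forall k h, P h -> P (x k * h)%g) -> P g.
  move=> P1 PM; apply: pres_group_ind => // k h Ph.
  by rewrite (mulg1_eq (pres_gen_invol k)); apply: PM.
have [b [d [c ->]]] := elliptic_normal_form pres_gen_invol central_gen_central
  triple_sq_central pres_gen_gt_nu gen_g.
set Z := intprod central_gen _ d; set T := intprod _ _ c.
pose sigmas := enum (@sigma_index nu m).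
pose lam := \sum_(i <- sigmas) tau i *~ c i.
pose shiftsF (h : G) a := shifts (F h) a.
have shiftsF1 : shiftsF 1%g 0 by rewrite /shiftsF (@gmulf1 _ _ F); apply: shifts1.
have shiftsFM h k a a' : shiftsF h a -> shiftsF k a' -> shiftsF (h * k)%g (a + a').
  by rewrite /shiftsF (@gmulfM _ _ F); apply: shiftsM.
have shiftsFV h a : shiftsF h a -> shiftsF h^-1%g (- a).
  by rewrite /shiftsF (@gmulfV _ _ F); apply: shiftsV.
(* Central factors shift by 0, so the total shift [lam] records exactly the exponents [c] of the
   translations. *)
have shiftsZT : shiftsF (Z * T)%g lam.
  rewrite -[lam]add0r; apply: (shiftsFM Z T).
    have -> : 0 = \sum_(p <- enum {: 'I_m.+1 * 'I_m.+1}) (0 : A) *~ d p.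
      by rewrite big1 // => p _; rewrite mul0rz.
    apply: (rel_intprod shiftsF1 shiftsFM shiftsFV) => p _.
    by have [kappa [_ _ /shifts_transvection]] := act_central_gen p.
  apply: (rel_intprod shiftsF1 shiftsFM shiftsFV) => i.
  by rewrite mem_enum /shiftsF (@gmulfM _ _ F) !F_gen => iP; apply: shifts_transl.
case: b; first by rewrite expg1 (@gmulfM _ _ F) F_gen => /(shifts_sign shiftsZT).
rewrite expg0 mul1g => FZT1.
have lam0 : iota lam *+ 2 = 0 by move: shiftsZT; rewrite /shiftsF FZT1; apply: shifts_id.
(* The coordinate of [lam] along [tau p] is [c p], and it vanishes because [iota lam *+ 2 = 0] in
   characteristic zero. *)
have T1 : T = 1%g.
  rewrite /T /intprod big_seq big1 // => p; rewrite mem_enum => pP.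
  have [h [_ [h_tau _]]] := dual_coords pP.
  suff -> : c p = 0 by [].
  have /eqP : h (iota lam *+ 2) = 0 by rewrite lam0 raddf0.
  have h_term i : @sigma_index nu m i -> h (iota (tau i *~ c i)) = (i == p)%:R *~ c i.
    by move=> iP; rewrite !raddfMz; congr (_ *~ _); apply: h_tau.
  rewrite raddfMn mulrn_eq0 /= /lam /sigmas big_enum /= !raddf_sum (bigD1 p) //=.
  rewrite big1 => [|i /andP[iP ip]]; last by rewrite [LHS]h_term // (negPf ip) mul0rz.
  by rewrite [h _]h_term // eqxx addr0 intr_eq0 => /eqP.
suff Z1 : Z = 1%g by rewrite T1 mulg1.
rewrite /Z /intprod big1 // => p0 _.
have [p0P|p0P] := boolP (ordered_pair nu p0); last first.
  rewrite /central_gen (negPf p0P); case: (d p0) => n /=; first exact: expg1n.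
  by rewrite expg1n invg1.
have [p01 p02] := ordered_pair_sigma p0P.
(* With [l] dual to [tau p0.1] and [h] dual to [tau p0.2], only the central factor at [p0] moves the
   [h] coordinate of the fibre over [l], by [kap p0 *~ d p0]. *)
have [h [_ [h_tau _]]] := dual_coords p02; have [_ [l [_ l_tau]]] := dual_coords p01.
have [kap kapP] := choice act_central_gen.
pose fiberF (g : G) k := fiber_shift h l (F g) k.
have fiberZ : fiberF Z (\sum_(p <- enum {: 'I_m.+1 * 'I_m.+1})
    (if p == p0 then kap p else 0) *~ d p).
  apply: rel_intprod => [|g1 g2 k1 k2|g1 k1|p _]; rewrite /fiberF.
  - by rewrite (@gmulf1 _ _ F); apply: fiber_shift1.
  - by rewrite (@gmulfM _ _ F); apply: fiber_shiftM.
  - by rewrite (@gmulfV _ _ F); apply: fiber_shiftV.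
  have [_ kap0 act_p] := kapP p.
  exists ((- (kap p * dual_eval l (tau p.2))) *: iota (tau p.1) +
      (kap p * dual_eval l (tau p.1)) *: iota (tau p.2)); last by move=> v; rewrite act_p.
  rewrite linearD !linearZ /=.
  have [pP|pP] := boolP (ordered_pair nu p); last first.
    by rewrite kap0 // !mul0r oppr0 !scale0r addr0 if_same.
  have [p1P p2P] := ordered_pair_sigma pP; rewrite !h_tau // !l_tau //.
  rewrite /GRing.scale /= mulNr -!mulrA.
  (* This product is nonzero only for the transpose of [p0], which is not an ordered pair. *)
  have -> : (p.2 == p0.1)%:R * (p.1 == p0.2)%:R = 0 :> K.
    case: eqP => [eq21|]; last by rewrite mul0r.
    case: eqP => [eq12|]; last by rewrite mulr0.
    have [_ lt_p _] := and3P pP; have [_ lt_p0 _] := and3P p0P.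
    by rewrite eq21 eq12 ltnNge (ltnW lt_p0) in lt_p.
  rewrite mulr0 oppr0 add0r -natrM mulnb -xpair_eqE -!surjective_pairing.
  by case: ifP; rewrite ?mulr1 ?mulr0.
move: FZT1 fiberZ; rewrite T1 mulg1 /fiberF => -> [b b_sum /(_ 0)].
rewrite act1 add0r => -[b0]; move: b_sum; rewrite -b0 raddf0 big_enum /= (bigD1 p0) //=.
rewrite eqxx big1 => [|p /negPf->]; last by rewrite mul0rz.
have [/(_ p0P) kap_neq0 _ _] := kapP p0.
move=> /esym/eqP; rewrite addr0 mulrz_eq0 (negPf kap_neq0) orbF => /eqP ->.
by [].
Qed.

End Isomorphism.

Lemma hyperbolic_weyl_group_presentation : isomorphic W G.
Proof.
have [F F_gen] := pres_group_lift rho_relator.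
apply: (isomorphic_of_bijective (f := F)).
have F_inj : injective F by apply: gmulf_inj; apply: kernel_trivial.
have F_surj : forall g, exists h, F h = g.
  by apply: (refl_generate (rho := x)) => k; rewrite F_gen.
have [F' F'K] := choice F_surj.
by exists F' => // h; apply: F_inj.
Qed.

End HyperbolicReflections.

Theorem proposition4p8
    (K : realType) (A : zmodType) (form : A -> A -> rat) (R : set A)
    (nu m : nat) (eps : A) (S : set A) (tau : 'I_m.+1 -> A)
    (V : vectType K) (iota : {additive A -> V}) (V0 : {vspace V})
    (hform : hyp_space V0 -> hyp_space V0 -> K) :
  ears_A1 form R nu ->
  A1_description form R eps S ->
  coset_description form nu S tau ->
  elliptic_like form nu eps tau ->
  is_scalar_extension iota ->
  is_linear_span [set iota s | s in radical form]%classic V0 ->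
  hyperbolic_form iota form eps hform ->
  isomorphic (hyperbolic_weyl_group iota hform R)
             (hyp_presentation form nu eps tau).
Proof.
move=> /ears_ars/ars_form form_psd R_desc S_desc elliptic iota_ext V0_span hyp_form.
(* The generators go to the reflections in [eps + std_tau k], which are roots by [std_tau_S], rather
   than in the [alpha_k] themselves. *)
have rho_ex k := refl_W form_psd R_desc iota_ext V0_span hyp_form
  (std_tau_S form_psd R_desc S_desc k).
have [rho rho_act] := choice rho_ex.
exact: (hyperbolic_weyl_group_presentation form_psd R_desc S_desc elliptic
  iota_ext V0_span hyp_form rho_act).
Qed.
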